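(* Let $c\geq 3$ be an integer and let $a$ be any residue modulo $c$. For a nonnegative integer $n$, let $\overline{N}(a,c,n)$ denote the number of overpartitions of $n$ whose rank is congruent to $a$ modulo $c$. Then \[ \overline{N}(a,c,n_1+n_2)<\overline{N}(a,c,n_1)\,\overline{N}(a,c,n_2) \] holds if $3\leq c\leq 5$ and $n_1,n_2\geq 9$, or if $c\geq 6$ and $n_1,n_2\geq M_c$, where \[ M_c=1.691\times 10^{13}\,c^{20}\exp\left(\frac{16c^2(2c^2+\pi)}{\pi^2}\right). \]
   Context: An overpartition of a nonnegative integer $n$ is a partition of $n$ (a non-increasing sequence of positive integers summing to $n$) in which the first occurrence of each distinct part may be overlined. For an overpartition $\lambda$, let $\ell(\lambda)$ be its largest part and $\#(\lambda)$ its number of parts; the rank of $\lambda$ (Lovejoy's overpartition rank) is $\mathrm{rank}(\lambda)=\ell(\lambda)-\#(\lambda)$. *)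

(* Defs.v *)
From HB Require Import structures.
From mathcomp Require Import all_boot all_order all_algebra.
From mathcomp Require Import all_classical all_reals all_analysis.

Set Implicit Arguments.
Unset Strict Implicit.
Unset Printing Implicit Defensive.

Import Order.TTheory GRing.Theory Num.Theory.

Local Open Scope nat_scope.

(* An overpartition is listed from its largest part down; the boolean attached
   to a part tells whether that occurrence of the part is overlined. *)
Definition parts (s : seq (nat * bool)) : seq nat := unzip1 s.

(* [index p (parts s)] is the position of the first occurrence of [p]. *)
Definition is_overpartition (n : nat) (s : seq (nat * bool)) : bool :=
  [&& sorted geq (parts s),
      all (fun p => 0 < p) (parts s),
      sumn (parts s) == n
    & [forall i : 'I_(size s), (nth (0, false) s i).2 ==>
         (index (nth (0, false) s i).1 (parts s) == i)]].

Definition largest_part (s : seq (nat * bool)) : nat :=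
  \max_(p <- parts s) p.

Definition overpartition_rank (s : seq (nat * bool)) : int :=
  ((largest_part s)%:Z - (size s)%:Z)%R.

(* An overpartition of [n] has at most [n] parts, each of them at most [n], so
   that all of them can be found in the finite type [n.-bseq ('I_n.+1 * bool)];
   see [unbound_inj] and [unbound_surj]. *)
Definition unbound (n : nat) (t : n.-bseq ('I_n.+1 * bool)) :
    seq (nat * bool) :=
  [seq (nat_of_ord x.1, x.2) | x <- t].

Lemma unbound_inj (n : nat) : injective (@unbound n).
Proof.
move=> t u /inj_map tu; apply/val_inj/tu.
by case=> [i b] [j d] /= [/val_inj -> ->].
Qed.

Lemma unbound_surj (n : nat) (s : seq (nat * bool)) :
  is_overpartition n s -> exists t : n.-bseq ('I_n.+1 * bool), unbound t = s.
Proof.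
case/and4P=> _ s_gt0 /eqP sumsn _.
have sz : size s <= n.
  rewrite -sumsn {sumsn}; elim: s s_gt0 => //= x s IHs /andP[x0 /IHs les].
  by rewrite -add1n leq_add.
have les x : x \in s -> x.1 < n.+1.
  rewrite ltnS -sumsn {s_gt0 sumsn sz} /parts; elim: s => //= y s IHs.
  rewrite inE => /orP[/eqP->|/IHs xs]; first exact: leq_addr.
  exact: leq_trans xs (leq_addl _ _).
pose f (x : nat * bool) : 'I_n.+1 * bool := (inord x.1, x.2).
have szf : size (map f s) <= n by rewrite size_map.
exists (Bseq szf); rewrite /unbound /= -map_comp -[RHS]map_id.
by apply/eq_in_map => -[p b] /les /= lepn; rewrite inordK.
Qed.

Definition Nbar (a : int) (c n : nat) : nat :=
  #|[set t : n.-bseq ('I_n.+1 * bool) |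
      is_overpartition n (unbound t) &&
      (overpartition_rank (unbound t) == a %[mod c%:Z])%Z]|.

Local Open Scope ring_scope.

Definition M (R : realType) (c : nat) : R :=
  1691 / 1000 * 10 ^+ 13 * c%:R ^+ 20 *
  expR (16 * c%:R ^+ 2 * (2 * c%:R ^+ 2 + pi) / pi ^+ 2).

(* Main.v *)
From Stdlib Require Import BinNat.
Require Import Defs.
From mathcomp Require Import all_boot all_order all_algebra.
From mathcomp Require Import all_classical all_reals all_analysis.
From mathcomp Require Import zify ring lra.

(* Equidistribution.  In an overpartition, exchange two parts 1 for one part 2:
   the number of parts drops by one, and the largest part is unchanged as long
   as a part greater than 1 remains.  Hence among the overpartitions that share
   their parts >= 3 and the total size of their parts 1 and 2, the ranks run
   through an interval, and comparing the two counts gives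
     pbar(n) <= c * Nbar(a, c, n + 2 c + 1),
   besides the trivial Nbar(a, c, n) <= pbar(n).

   Inequalities for pbar.  The logarithmic derivative of the generating function
   gives n pbar(n) = sum_(k >= 1) s(k) pbar(n - k), with 2 k <= s(k) <= k (k + 1).
   Suppose C pbar(b' + e) <= D pbar(b') for all b' < b.  Expanding
   (b + e) pbar(b + e) by the recurrence and applying the hypothesis termwise
   yields at most D b pbar(b) plus boundary terms, and the slack D e pbar(b)
   absorbs the boundary terms once b is large.  So such an inequality follows
   from finitely many cases; D = pbar(a), e = a + d gives strong forms of
   submultiplicativity.

   For 3 <= c <= 5 this leaves a finite set of pairs (n1, n2), decided with exact
   tables.  For c >= 6 the same induction, with the weight 1/a + 1/b, gives
   pbar(a + b) <= K (1/a + 1/b) pbar(a) pbar(b), and the right-hand side beats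
   every constant factor because n1 and n2 exceed M_c. *)

Set Implicit Arguments.
Unset Strict Implicit.
Unset Printing Implicit Defensive.

Import Order.TTheory GRing.Theory Num.Theory.

Local Open Scope nat_scope.

(** * Enumeration of overpartitions *)

Notation oseq := (seq (nat * bool)).

(* Overpartitions whose parts are at most [l], with no overlined [l]. *)
Fixpoint dval (l : nat) (s : oseq) : bool :=
  if s is y :: s' then
    [&& 0 < y.1, (y.1 < l) || ((y.1 == l) && ~~ y.2) & dval y.1 s']
  else true.

(** [dval y.1] constrains what follows a part [y], where a further copy of [y.1] can no longer be
    overlined; [vval] is the condition at the start. *)
Definition vval (l : nat) (s : oseq) : bool :=
  if s is y :: s' then (0 < y.1 <= l) && dval y.1 s' else true.

Definition weight (s : oseq) : nat := sumn (parts s).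

Lemma dvalS (l : nat) (s : oseq) :
  dval l.+1 s = vval l s ||
    (if s is y :: s' then (y == (l.+1, false)) && dval l.+1 s' else false).
Proof.
case: s => [|[x b] s] //=; rewrite ltnS xpair_eqE eqbF_neg.
case: (ltnP 0 x) => [x0|] /=; last by rewrite leqn0 => /eqP ->.
case: (leqP x l) => [xl|] /=.
  by rewrite (_ : (x == l.+1) = false) ?orbF //; apply/eqP; lia.
by case: eqP => // ->.
Qed.

Lemma vvalS (l : nat) (s : oseq) :
  vval l.+1 s = dval l.+1 s ||
    (if s is y :: s' then (y == (l.+1, true)) && dval l.+1 s' else false).
Proof.
case: s => [|[x b] s] //=; rewrite xpair_eqE eqb_id.
case: (ltnP 0 x) => [x0|] /=; last by rewrite leqn0 => /eqP ->.
rewrite leq_eqVlt; case: eqP => [->|_] /=; last by rewrite !orbF.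
by rewrite ltnn /=; case: b => //=; rewrite orbF.
Qed.

Lemma dval_le (l : nat) (s : oseq) : dval l s -> all (geq l) (parts s).
Proof.
elim: s l => //= -[x b] s IHs l /= /and3P[x0 xl /IHs sx].
have lex : x <= l by case/orP: xl => [/ltnW|/andP[/eqP ->]].
by rewrite lex /=; apply: sub_all sx => y /= /leq_trans; apply.
Qed.

Definition overline_first (s : oseq) : bool :=
  [forall i : 'I_(size s), (nth (0, false) s i).2 ==>
         (index (nth (0, false) s i).1 (parts s) == i)].

Lemma overline_first_cons (x : nat) (b : bool) (s : oseq) :
  overline_first ((x, b) :: s) =
  overline_first s && all (fun y => y.2 ==> (y.1 != x)) s.
Proof.
apply/forallP/andP => /= [H|[/forallP H1 /allP H2]].
  split; last first.
    apply/allP => y /(nthP (0, false))[i isz <-].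
    have /= := H (Ordinal (isz : i.+1 < (size s).+1)).
    case: (nth _ s i) => p [] //=; rewrite (eq_sym p).
    by case: (x =P p).
  apply/forallP => /= -[i isz] /=.
  have /= := H (Ordinal (isz : i.+1 < (size s).+1)).
  case: (nth _ s i) => p [] //=.
  by case: (x =P p).
move=> [[|i] isz] /=; first by rewrite eqxx /= implybT.
have {}isz : i < size s by [].
have := H1 (Ordinal isz); have := H2 _ (mem_nth (0, false) isz).
by case: (nth _ s i) => p [] //=; rewrite (eq_sym p) => /negPf ->.
Qed.

Lemma dvalE (l : nat) (s : oseq) :
  dval l s = [&& path geq l (parts s), all (fun p => 0 < p) (parts s),
    overline_first s & all (fun y => y.2 ==> (y.1 != l)) s].
Proof.
elim: s l => [|[x b] s IHs] l /=.
  by symmetry; rewrite andbT; apply/forallP => -[].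
rewrite IHs overline_first_cons.
case: (ltnP 0 x) => x0 /=; last by rewrite andbF.
case: (ltngtP x l) => [xl|//|->] /=; last first.
- by case: b; rewrite ?andbF //= -!andbA; do !bool_congr; rewrite andbb.
rewrite implybT /= -!andbA; case: (boolP (path _ _ _)) => //= sx.
suff -> : all (fun y : nat * bool => y.2 ==> (y.1 != l)) s by rewrite andbT.
apply/allP => y ys; apply/implyP => _.
have : y.1 \in parts s by apply: map_f.
have /allP/[apply] /= : all (geq x) (parts s).
  by apply: order_path_min sx => u v w /= uv vw; exact: leq_trans vw uv.
by move=> yx; apply/eqP; lia.
Qed.

Lemma is_overpartitionE (n : nat) (s : oseq) :
  is_overpartition n s = vval n s && (weight s == n).
Proof.
rewrite /is_overpartition /weight -/(overline_first s).
case: eqP => sn; last by rewrite !andbF.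
rewrite andbT; case: s sn => [|[x b] s] /= sn.
  by apply/forallP => -[].
rewrite overline_first_cons dvalE /=.
have -> : x <= n by lia.
by rewrite andbT; case: (0 < x); rewrite ?andbF.
Qed.

(** Puts plain parts [L] in front of sequences from [f]. For positive [L], fuel [k >= n] suffices,
    as each copy lowers the weight. *)
Fixpoint addp_rec (L : nat) (f : nat -> seq oseq) (k n : nat) : seq oseq :=
  f n ++ (if k is k'.+1 then
            if L <= n then map (cons (L, false)) (addp_rec L f k' (n - L))
            else [::]
          else [::]).

Definition addp L f n := addp_rec L f n n.

Lemma addp_rec_fuel (L : nat) f (k n : nat) :
  0 < L -> n <= k -> addp_rec L f k n = addp L f n.
Proof.
rewrite /addp => L0; elim/ltn_ind: n k => n IHn [|k] nk.
  by have -> : n = 0 by lia.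
case: n IHn nk => [|n] IHn nk /=; first by rewrite leqNgt L0.
case: leqP => // Ln; congr (_ ++ map _ _).
by rewrite (IHn _ _ k) ?(IHn _ _ n) //; lia.
Qed.

Lemma addpE (L : nat) f (n : nat) : 0 < L ->
  addp L f n = f n ++
    (if L <= n then map (cons (L, false)) (addp L f (n - L)) else [::]).
Proof.
move=> L0; rewrite {1}/addp; case: n => [|n] /=; first by rewrite leqNgt L0.
by case: leqP => // Ln; rewrite addp_rec_fuel //; lia.
Qed.

Fixpoint ovs (L n : nat) : seq oseq :=
  if L is L'.+1 then
    addp L (ovs L') n ++
      (if L <= n then map (cons (L, true)) (addp L (ovs L') (n - L)) else [::])
  else if n == 0 then [:: [::]] else [::].

Lemma mem_cons_map (y : nat * bool) (A : seq oseq) (s : oseq) :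
  (s \in map (cons y) A) = (if s is z :: s' then (z == y) && (s' \in A) else false).
Proof.
case: s => [|z s]; first by apply/mapP => -[].
apply/mapP/andP => [[t tA [-> ->]]|[/eqP -> sA]]; first by rewrite eqxx.
by exists s.
Qed.

Lemma mem_addp (L : nat) (f : nat -> seq oseq) :
  (forall n s, (s \in f n) = vval L s && (weight s == n)) ->
  forall n s, (s \in addp L.+1 f n) = dval L.+1 s && (weight s == n).
Proof.
move=> fP; elim/ltn_ind => n IHn s; rewrite addpE // mem_cat fP dvalS andb_orl.
congr orb; case: (leqP L.+1 n) => Ln.
  rewrite mem_cons_map; case: s => //= z s.
  case: eqP => //= ->; rewrite IHn ?ltn_subrL //=; last by lia.
  by congr andb; rewrite /weight /=; apply/eqP/eqP; lia.
rewrite in_nil; case: s => //= z s; case: eqP => //= ->.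
by apply/esym/negbTE; rewrite /weight /= negb_and; apply/orP; right; apply/eqP; lia.
Qed.

Lemma mem_ovs (L n : nat) (s : oseq) :
  (s \in ovs L n) = vval L s && (weight s == n).
Proof.
elim: L n s => [|L IHL] n s /=.
  case: s => [|y s] /=; last first.
    by rewrite leqn0; case: ifP; case: (y.1).
  by rewrite /weight /= eq_sym; case: eqP.
rewrite mem_cat (mem_addp IHL) vvalS andb_orl; congr orb.
case: (leqP L.+1 n) => Ln.
  rewrite mem_cons_map; case: s => //= z s.
  case: eqP => //= ->; rewrite (mem_addp IHL) //=.
  by congr andb; rewrite /weight /=; apply/eqP/eqP; lia.
rewrite in_nil; case: s => //= z s; case: eqP => //= ->.
by apply/esym/negbTE; rewrite /weight /= negb_and; apply/orP; right; apply/eqP; lia.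
Qed.

Lemma uniq_addp (L n : nat) :
  (forall m, uniq (ovs L m)) -> uniq (addp L.+1 (ovs L) n).
Proof.
move=> uf; elim/ltn_ind: n => n IHn.
rewrite addpE // cat_uniq uf /=; case: (leqP L.+1 n) => Ln //=.
rewrite map_inj_uniq ?IHn ?andbT; [|by lia|by move=> ? ? []].
apply/hasPn => s; rewrite mem_cons_map mem_ovs; case: s => // z s /andP[/eqP -> _] /=.
by rewrite ltnn.
Qed.

Lemma uniq_ovs (L n : nat) : uniq (ovs L n).
Proof.
elim: L n => [|L IHL] n /=; first by case: ifP.
rewrite cat_uniq uniq_addp //=; case: (leqP L.+1 n) => Ln //=.
rewrite map_inj_uniq ?uniq_addp ?andbT //; last by move=> ? ? [].
apply/hasPn => s; rewrite mem_cons_map (mem_addp (mem_ovs L)); case: s => // z s.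
by move=> /andP[/eqP -> _] /=; rewrite ltnn eqxx.
Qed.

Definition rank_pred (a : int) (c : nat) (s : oseq) : bool :=
  (overpartition_rank s == a %[mod c%:Z])%Z.

Lemma NbarE (a : int) (c n : nat) : Nbar a c n = count (rank_pred a c) (ovs n n).
Proof.
rewrite /Nbar cardE -(size_map (@unbound n)) -size_filter.
apply: perm_size; apply: uniq_perm.
- by rewrite (map_inj_uniq (@unbound_inj n)) enum_uniq.
- exact/filter_uniq/uniq_ovs.
move=> s; rewrite mem_filter mem_ovs -is_overpartitionE.
apply/mapP/andP => [[t]|[rs os]].
  by rewrite mem_enum inE => /andP[ot rt] ->.
have [t ts] := unbound_surj os.
by exists t => //; rewrite mem_enum inE ts os.
Qed.

Definition cnt (L : nat) (Q : pred nat) (n : nat) : nat :=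
  count (fun s => Q (size s)) (ovs L n).

(** Counts the sequences that may follow a part [L]. The predicate [Q] sees only the number of
    parts, which gives the rank once the largest part is known. *)
Definition dnt (L : nat) (Q : pred nat) (n : nat) : nat :=
  count (fun s => Q (size s)) (addp L (ovs L.-1) n).

Definition rnk (a : int) (c L n : nat) : nat := count (rank_pred a c) (ovs L n).

Lemma cnt0 (Q : pred nat) (n : nat) : cnt 0 Q n = (n == 0) && Q 0.
Proof. by rewrite /cnt /=; case: eqP => //= _; rewrite addn0. Qed.

Lemma dntS (L : nat) (Q : pred nat) (n : nat) :
  dnt L.+1 Q n = cnt L Q n +
    (if L < n then dnt L.+1 (fun k => Q k.+1) (n - L.+1) else 0).
Proof.
rewrite /dnt addpE //= count_cat; congr addn.
by case: (leqP L.+1 n) => // _; rewrite count_map.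
Qed.

(** The doubling comes from the first part [L.+1], overlined or not; the same sequences may follow
    in both cases. *)
Lemma cntS (L : nat) (Q : pred nat) (n : nat) :
  cnt L.+1 Q n = cnt L Q n +
    (if L < n then (dnt L.+1 (fun k => Q k.+1) (n - L.+1)).*2 else 0).
Proof.
rewrite {1}/cnt /= count_cat -/(dnt L.+1 Q n) dntS -addnA; congr addn.
by case: (leqP L.+1 n) => // _; rewrite count_map -addnn.
Qed.

Definition rank_class (a : int) (c L k : nat) : bool :=
  ((L%:Z - k%:Z)%R == a %[mod c%:Z])%Z.

Lemma largest_cons (L : nat) (b : bool) (s : oseq) :
  dval L s -> largest_part ((L, b) :: s) = L.
Proof.
move=> /dval_le sL; rewrite /largest_part /= big_cons /=.
apply/maxn_idPl; apply/bigmax_leqP_seq => i.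
by move=> /(allP sL).
Qed.

(** Every sequence that the step adds has largest part exactly [L.+1], which turns the rank
    condition into one on the number of parts. *)
Lemma rnkS (a : int) (c L n : nat) :
  rnk a c L.+1 n = rnk a c L n +
    (if L < n then (dnt L.+1 (fun k => rank_class a c L.+1 k.+1) (n - L.+1)).*2
     else 0).
Proof.
rewrite {1}/rnk /= addpE // !count_cat -/(rnk a c L n) -addnA; congr addn.
case: (leqP L.+1 n) => // _; rewrite !count_map -addnn /dnt.
by congr addn; apply: eq_in_count => s; rewrite (mem_addp (mem_ovs L)) => /andP[/largest_cons sL _];
  rewrite /= /rank_pred /overpartition_rank sL.
Qed.

(** * The recurrence *)

Definition ov (L n : nat) : nat := cnt L xpredT n.

Definition pbar (n : nat) : nat := ov n n.

Lemma cnt_stable (L n : nat) (Q : pred nat) : n <= L -> cnt L Q n = cnt n Q n.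
Proof.
move=> /subnKC <-; elim: (L - n) => [|k IHk]; first by rewrite addn0.
by rewrite addnS cntS IHk ltnNge leq_addr addn0.
Qed.

Lemma ov_stable (L n : nat) : n <= L -> ov L n = pbar n.
Proof. exact: cnt_stable. Qed.

(** With F_L the generating function of [ov L], this is (1 - q^(L+1)) F_(L+1) = (1 + q^(L+1))
    F_L. *)
Lemma ovS (L n : nat) :
  ov L.+1 n = ov L n + (if L < n then ov L (n - L.+1) + ov L.+1 (n - L.+1) else 0).
Proof.
have ovd m : ov L m + ov L.+1 m = (dnt L.+1 xpredT m).*2.
  rewrite /ov cntS [in RHS]dntS doubleD -(addnn (cnt L xpredT m)) addnA.
  by congr addn; case: ifP.
by rewrite {1}/ov cntS ovd.
Qed.

Definition conv (s f : nat -> nat) (n : nat) : nat :=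
  \sum_(0 <= k < n.+1) s k * f (n - k).

Lemma convD (s s' f : nat -> nat) (n : nat) :
  conv (fun k => s k + s' k) f n = conv s f n + conv s' f n.
Proof. by rewrite /conv -big_split; apply: eq_bigr => k _; rewrite mulnDl. Qed.

(* The coefficients of [2 L q^L / (1 - q^(2 L))], the logarithmic derivative of
   [(1 + q^L) / (1 - q^L)]. *)
Definition tcoef (L k : nat) : nat :=
  if (L %| k) && odd (k %/ L) then L.*2 else 0.

(** The hypotheses express G = F (1 + q^L) / (1 - q^L) for the generating functions of [f] and
    [g]. *)
Section LogDerivative.

Variables (L : nat) (f g : nat -> nat).
Hypothesis L_gt0 : 0 < L.
Hypothesis g_small : forall n, n < L -> g n = f n.
Hypothesis gE : forall n, g (n + L) = f (n + L) + f n + g n.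

Lemma tcoef_neq (k : nat) : k < L.*2 -> k != L -> tcoef L k = 0.
Proof.
move=> kL kNL; rewrite /tcoef; case: dvdnP => // -[j kE].
rewrite {}kE mulnK //= in kL kNL *.
have : j < 2 by rewrite -mul2n ltn_mul2r in kL; case/andP: kL.
by case: j kNL kL => [|[|]] //; rewrite mul1n eqxx.
Qed.

Lemma tcoef_period (k : nat) : tcoef L (L.*2 + k) = tcoef L k.
Proof.
rewrite /tcoef dvdn_addr -?muln2 ?dvdn_mulr //.
by rewrite divnDl ?dvdn_mulr // mulKn // oddD.
Qed.

Lemma sum_tcoef (N : nat) (F : nat -> nat) :
  L < N <= L.*2 -> \sum_(0 <= k < N) tcoef L k * F k = L.*2 * F L.
Proof.
move=> /andP[LN NL]; rewrite (big_cat_nat (n := L)) //=; last exact: ltnW.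
rewrite big_nat big1 => [|k /= kL]; last by rewrite tcoef_neq //; lia.
rewrite add0n big_ltn // big_nat big1 => [|k /= kL].
  by rewrite addn0 /tcoef dvdnn divnn L_gt0.
by rewrite tcoef_neq //; lia.
Qed.

Lemma conv_tcoef_small (n : nat) : n < L -> conv (tcoef L) g n = 0.
Proof.
by move=> nL; rewrite /conv big_nat big1 // => k kn; rewrite tcoef_neq //; lia.
Qed.

Lemma conv_tcoef2 (n : nat) :
  conv (tcoef L) g (L.*2 + n) = L.*2 * g (L + n) + conv (tcoef L) g n.
Proof.
rewrite {1}/conv (big_cat_nat (n := L.*2)) //=; last by lia.
rewrite sum_tcoef; last by lia.
congr (_ * g _ + _); first by lia.
rewrite -[X in \sum_(X <= _ < _) _]add0n big_addn -addnS addKn.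
by apply: eq_bigr => k _; rewrite [k + _]addnC tcoef_period; congr (_ * g _); lia.
Qed.

(** With T = 2 L q^L / (1 - q^(2 L)) this reads (1 - q^L) T G = L q^L (F + G); both sides equal 2 L
    q^L F / (1 - q^L). *)
Lemma conv_tcoef (n : nat) :
  conv (tcoef L) g (n + L) = conv (tcoef L) g n + L * (f n + g n).
Proof.
elim/ltn_ind: n => n IHn; case: (ltnP n L) => nL.
  rewrite (conv_tcoef_small nL) /conv sum_tcoef; last by lia.
  by rewrite addnK g_small // addnn -mul2n -!muln2; lia.
have [m nE] : exists m, n = m + L by exists (n - L); rewrite subnK.
have {IHn} IHm := IHn m; subst n.
rewrite [m + L + L](_ : _ = L.*2 + m); last by lia.
rewrite conv_tcoef2 IHm ?[L + m]addnC ?gE; last by lia.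
by rewrite -mul2n !mulnDr; lia.
Qed.

Lemma log_derivative_step (s : nat -> nat) :
  (forall n, n * f n = conv s f n) ->
  forall n, n * g n = conv (fun k => s k + tcoef L k) g n.
Proof.
move=> fP; elim/ltn_ind => n IHn; rewrite convD; case: (ltnP n L) => nL.
  rewrite (conv_tcoef_small nL) addn0 g_small // fP.
  by apply: eq_big_nat => k kn; rewrite g_small //; lia.
have nE : n = (n - L) + L by rewrite subnK.
have {IHn} := IHn (n - L); rewrite ltn_subrL L_gt0 (leq_trans L_gt0) // => /(_ isT).
rewrite nE addnK; move: (n - L) => m {n nE nL} IHm.
rewrite convD in IHm.
rewrite conv_tcoef gE.
(* For k <= m the argument m + L - k is at least L and [gE] applies; for k > m it is below L, where
   [g] and [f] agree. *)
have -> : conv s g (m + L) = conv s f (m + L) + conv s f m + conv s g m.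
  rewrite /conv (big_cat_nat (n := m.+1)) //=; last by lia.
  rewrite [\sum_(0 <= k < (m + L).+1) _ * f _](big_cat_nat (n := m.+1)) //=; last by lia.
  rewrite [X in X + _](_ : _ = \sum_(0 <= k < m.+1) s k * f (m + L - k) +
     \sum_(0 <= k < m.+1) s k * f (m - k) + \sum_(0 <= k < m.+1) s k * g (m - k)).
    rewrite [X in _ + X = _](_ : _ = \sum_(m.+1 <= k < (m + L).+1) s k * f (m + L - k)).
      by lia.
    by apply: eq_big_nat => k km; rewrite g_small //; lia.
  rewrite -!big_split; apply: eq_big_nat => k km /=.
  have -> : m + L - k = (m - k) + L by lia.
  by rewrite gE !mulnDr.
by rewrite -!fP; lia.
Qed.

End LogDerivative.

Definition sL (L k : nat) : nat := \sum_(1 <= i < L.+1) tcoef i k.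

Definition ssum (k : nat) : nat := sL k k.

Lemma ov_rec (L n : nat) : n * ov L n = conv (sL L) (ov L) n.
Proof.
elim: L n => [|L IHL] n.
  rewrite /conv big_nat big1 => [|k _]; last by rewrite /sL big_geq.
  by rewrite /ov cnt0; case: n => //= n; rewrite muln0.
have := @log_derivative_step L.+1 (ov L) (ov L.+1) isT _ _ (sL L) IHL n.
move=> -> //.
- by apply: eq_bigr => k _; rewrite /sL [in RHS]big_nat_recr.
- by move=> m mL; rewrite ovS ltnNge -ltnS mL addn0.
- by move=> m; rewrite ovS addnK -addnA [L < _](_ : _ = true) //; lia.
Qed.

Lemma ssum0 : ssum 0 = 0.
Proof. by rewrite /ssum /sL big_geq. Qed.

Lemma sL_stable (L k : nat) : k <= L -> sL L k = ssum k.
Proof.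
move=> kL; rewrite /ssum /sL (big_cat_nat (n := k.+1)) //= -[RHS]addn0; congr addn.
rewrite big_nat big1 // => i /andP[ki _]; rewrite /tcoef.
case: k ki {kL} => [|k] ki; first by rewrite div0n andbF.
by rewrite [i %| _](_ : _ = false) //; apply/negP => /dvdn_leq; lia.
Qed.

Lemma pbar_rec (n : nat) :
  n * pbar n = \sum_(0 <= i < n) ssum (n - i) * pbar i.
Proof.
rewrite /pbar ov_rec /conv big_nat_rev /= big_nat_recr //= !add0n subnn.
rewrite sL_stable // ssum0 mul0n addn0.
apply: eq_big_nat => i /andP[_ iln].
by rewrite sL_stable ?ov_stable; [congr (_ * pbar _)|..]; lia.
Qed.

Lemma ssum_ge (k : nat) : 2 * k <= ssum k.
Proof.
case: k => // k; rewrite /ssum /sL big_nat_recr //= /tcoef dvdnn divnn /=.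
by rewrite -mul2n leq_addl.
Qed.

Lemma ssum_le (k : nat) : ssum k <= k * k.+1.
Proof.
apply: (@leq_trans (\sum_(1 <= i < k.+1) i.*2)).
  by apply: leq_sum => i _; rewrite /tcoef; case: ifP.
elim: k => [|k IHk]; first by rewrite big_geq.
by rewrite big_nat_recr //=; lia.
Qed.

(** * Equidistribution of the rank *)

(** All that the comparison uses of a residue class modulo [c]. Unlike a fixed class, the property
    survives the shift of [Q] caused by removing a part. *)
Definition hits (c : nat) (Q : pred nat) : Prop :=
  forall x, exists2 i, i < c & Q (x + i).

Lemma hitsS (c : nat) (Q : pred nat) : hits c Q -> hits c (fun k => Q k.+1).
Proof. by move=> hQ x; have [i ic Qi] := hQ x.+1; exists i. Qed.

Lemma hits_rank_class (a : int) (c L : nat) : 0 < c -> hits c (rank_class a c L).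
Proof.
move=> c0 x; pose d := (L%:Z - x%:Z - a)%R.
have cz : (c%:Z != 0)%R by rewrite eqz_nat -lt0n.
have m0 := modz_ge0 d cz.
have mE : (`|(d %% c%:Z)%Z|%N%:Z = (d %% c%:Z)%Z)%R by rewrite gez0_abs.
exists `|(d %% c%:Z)%Z|%N.
  by rewrite -ltz_nat mE ltz_pmod.
rewrite /rank_class eqz_mod_dvd PoszD mE.
have -> : (L%:Z - (x%:Z + (d %% c%:Z)%Z) - a = (d %/ c%:Z)%Z * c%:Z)%R.
  by have := divz_eq d c%:Z; rewrite {1}/d; lia.
exact: dvdz_mull.
Qed.

Lemma hits_window (c : nat) (Q : pred nat) (q w x : nat) :
  hits c Q -> q * c <= w -> q <= \sum_(0 <= j < w) Q (x + j).
Proof.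
move=> hQ; elim: q w x => // q IHq w x qw.
have cw : c <= w by rewrite mulSn in qw; lia.
rewrite (big_cat_nat (n := c)) //= -add1n leq_add //.
  have [i ic Qi] := hQ x.
  by rewrite big_mkord (bigD1 (Ordinal ic)) //= Qi.
rewrite -[X in \sum_(X <= _ < _) _]add0n big_addn.
have {}qw : q * c <= w - c by rewrite mulSn in qw; lia.
apply: (leq_trans (IHq _ (x + c) qw)).
by apply: leq_sum => j _; rewrite -addnA [c + j]addnC.
Qed.

Lemma dnt1 (Q : pred nat) (n : nat) : dnt 1 Q n = Q n.
Proof.
elim: n Q => [|n IHn] Q; rewrite dntS cnt0 /= ?addn0 //.
by rewrite subn1 /= IHn.
Qed.

Lemma cnt1 (Q : pred nat) (n : nat) : cnt 1 Q n = if n is 0 then Q 0 : nat else (Q n).*2.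
Proof. by rewrite cntS cnt0; case: n => [|n] /=; rewrite ?addn0 // dnt1 subn1. Qed.

(** With j parts 2 and n - 2 j > 0 parts 1 there are n - j parts, and the first 1 may be overlined;
    [uphalf n] counts these j. *)
Lemma dnt2_sum (Q : pred nat) (n : nat) :
  2 * (\sum_(0 <= j < uphalf n) Q (n - j)) <= dnt 2 Q n.
Proof.
elim/ltn_ind: n Q => -[|[|n]] IHn Q; first by rewrite big_geq.
  by rewrite big_nat1 dntS cnt1 addn0 subn0 -mul2n.
rewrite /= big_ltn // mulnDr dntS cnt1 subn0 -mul2n leq_add2l /= subn2 /=.
apply: leq_trans (IHn n _ (fun k => Q k.+1)); last by [].
rewrite big_add1 /= leq_mul2l /= !big_nat; apply: leq_sum => j /andP[_ jn].
have {}jn : j <= n by lia.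
by rewrite subSS subSn.
Qed.

Lemma dnt2_ge (c n : nat) (Q : pred nat) :
  0 < c -> hits c Q -> 2 * (uphalf n %/ c) <= dnt 2 Q n.
Proof.
move=> c0 hQ; apply: leq_trans (dnt2_sum Q n); rewrite leq_mul2l /= big_nat_rev /=.
apply: (leq_trans (hits_window (n - (uphalf n).-1) hQ (leq_divM _ _))).
rewrite !big_nat; apply: leq_sum => j jn.
by rewrite (_ : n - (0 + _ - _) = n - (uphalf n).-1 + j) //; lia.
Qed.

Lemma ov2_le (n : nat) : ov 2 n <= 2 * n + 1.
Proof.
have ov1 m : ov 1 m <= 2 by rewrite /ov cnt1; case: m.
elim/ltn_ind: n => n IHn; rewrite ovS; case: ltnP => n2.
  by have := IHn (n - 2); have := ov1 n; have := ov1 (n - 2); lia.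
by case: n n2 {IHn} => [|[|]] // _; rewrite /ov cnt1.
Qed.

Section Equidistribution.

Variable c : nat.
Hypothesis c_gt0 : 0 < c.

Lemma ov2_le_dnt (n : nat) (Q : pred nat) : hits c Q ->
  ov 2 n <= c * (dnt 2 Q (n + c.*2.+1 - 2)).*2.
Proof.
move=> hQ; apply: (leq_trans (ov2_le n)).
have := dnt2_ge (n + c.*2.+1 - 2) c_gt0 hQ.
(* The shift 2 c + 1 adds c to the number of admissible j, hence 1 to its quotient by c, and c (n./2
   %/ c + 1) exceeds n./2. *)
have -> : uphalf (n + c.*2.+1 - 2) = n./2 + c by lia.
rewrite divnDr ?dvdnn // divnn c_gt0 addn1.
have := ltn_ceil n./2 c_gt0; move: (n./2 %/ c).+1 (dnt 2 Q _) => u v; rewrite mulnC.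
by move=> nu /(leq_mul (leqnn (2 * c))); lia.
Qed.

(** Both sides obey the same recurrence, and removing a part leaves the shift 2 c + 1 untouched, so
    the bound passes on term by term. *)
Lemma ov_le_dnt (L : nat) :
  (forall Q n, hits c Q -> ov L n <= c * cnt L Q (n + c.*2.+1)) ->
  forall Q n, hits c Q -> dnt L.+1 xpredT n <= c * dnt L.+1 Q (n + c.*2.+1).
Proof.
move=> IHL Q n; elim/ltn_ind: n Q => n IHn Q hQ.
rewrite dntS [in leqRHS]dntS mulnDr leq_add ?IHL //.
case: ifP => // Ln; rewrite ltn_addr // -addnBAC //.
by apply: IHn; [lia | exact: hitsS].
Qed.

Lemma ov_le_cnt (L n : nat) (Q : pred nat) : 2 <= L -> hits c Q ->
  ov L n <= c * cnt L Q (n + c.*2.+1).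
Proof.
case: L => [|[|L]] // _; elim: L n Q => [|L IHL] n Q hQ.
  rewrite cntS mulnDr; apply: leq_trans (leq_addl _ _).
  by rewrite (_ : 1 < _); [exact/ov2_le_dnt/hitsS | lia].
rewrite /ov cntS [in leqRHS]cntS mulnDr leq_add ?IHL //.
case: ifP => // Ln; rewrite ltn_addr // -addnBAC // -doubleMr leq_double.
by apply: ov_le_dnt => [Q' m hQ'|]; [exact: IHL | exact: hitsS].
Qed.

Lemma ov_le_rnk (a : int) (L n : nat) : 2 <= L ->
  ov L n <= c * rnk a c L (n + c.*2.+1).
Proof.
case: L => [|[|L]] // _; elim: L n => [|L IHL] n.
  rewrite rnkS mulnDr; apply: leq_trans (leq_addl _ _).
  by rewrite (_ : 1 < _); [exact/ov2_le_dnt/hitsS/hits_rank_class | lia].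
rewrite /ov cntS rnkS mulnDr leq_add ?IHL //.
case: ifP => // Ln; rewrite ltn_addr // -addnBAC // -doubleMr leq_double.
apply: ov_le_dnt => [Q m|]; first exact: ov_le_cnt.
exact/hitsS/hits_rank_class.
Qed.

Lemma pbar_le_Nbar (a : int) (n : nat) : pbar n <= c * Nbar a c (n + c.*2.+1).
Proof.
by rewrite NbarE -(@ov_stable (n + c.*2.+1)) ?leq_addr // ov_le_rnk //; lia.
Qed.

End Equidistribution.

Lemma Nbar_le_pbar (a : int) (c n : nat) : Nbar a c n <= pbar n.
Proof.
by rewrite NbarE /pbar /ov /cnt count_predT count_size.
Qed.

(** * Propagation of inequalities through the recurrence *)

Lemma ov_homo (L : nat) : {homo ov L.+1 : m n / m <= n}.
Proof.
apply: homo_leq => //; first exact: leq_trans.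
elim: L => [|L IHL] n; first by rewrite /ov !cnt1; case: n.
elim/ltn_ind: n => n IHn; rewrite ovS [leqRHS]ovS leq_add ?IHL //.
case: (ltnP L.+1 n) => // Ln.
have -> : L.+1 < n.+1 by lia.
by rewrite subSn // leq_add ?IHL //; apply: IHn; lia.
Qed.

Lemma pbar_homo : {homo pbar : m n / m <= n}.
Proof.
move=> m n mn; rewrite -(@ov_stable n.+1) -?(@ov_stable n.+1 n) //; last by lia.
exact: ov_homo.
Qed.

Lemma pbar0 : pbar 0 = 1.
Proof. by rewrite /pbar /ov cnt0. Qed.

Lemma pbar_gt0 (n : nat) : 0 < pbar n.
Proof. by apply: (@leq_trans (pbar 0)); [rewrite pbar0 | exact: pbar_homo]. Qed.

(** Keep the terms i >= m of the recurrence: each [pbar i] is at least [pbar m], and the weights are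
    at least 2 h, 2 (h - 1), ..., 2, with sum h (h + 1). *)
Lemma pbar_growth (m h : nat) : h * h.+1 * pbar m <= (m + h) * pbar (m + h).
Proof.
rewrite pbar_rec (big_cat_nat (n := m)) ?leq_addr //=.
apply: leq_trans (leq_addl _ _).
rewrite -[X in \sum_(X <= _ < _) _]add0n big_addn addKn.
apply: (@leq_trans (\sum_(0 <= i < h) 2 * (h - i) * pbar m)).
  rewrite -big_distrl /= leq_mul2r; apply/orP; right.
  elim: h => [|h IHh]; first by rewrite big_geq.
  rewrite big_ltn // big_add1 /= subn0.
  by under eq_bigr do rewrite subSS; move: IHh; lia.
rewrite !big_nat; apply: leq_sum => i /andP[_ ih]; apply: leq_mul.
  by rewrite (_ : h - i = m + h - (i + m)) ?ssum_ge //; lia.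
by apply: pbar_homo; rewrite leq_addl.
Qed.

(** Induction from m = n - n %/ 8 to n: m^3 >= (343/512) n^3, while [pbar_growth] gains h (h + 1) /
    n >= 512/343 once n >= 110. The condition 7 n >= 8 n0 keeps m >= n0. *)
Lemma cubic_growth (K n0 : nat) :
  (forall n, n0 <= n -> n < 110 \/ 7 * n < 8 * n0 -> K * n ^ 3 <= pbar n) ->
  forall n, n0 <= n -> K * n ^ 3 <= pbar n.
Proof.
move=> base; elim/ltn_ind => n IHn n0n.
case: (ltnP n 110) => [n110|n110]; first by apply: base => //; left.
case: (ltnP (7 * n) (8 * n0)) => [|n8]; first by move=> ?; apply: base => //; right.
have nE : n = (n - n %/ 8) + n %/ 8 by lia.
have := pbar_growth (n - n %/ 8) (n %/ 8); rewrite -nE.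
have := IHn (n - n %/ 8); set m := n - _; set h := n %/ 8 => IHm.
have {}IHm : K * m ^ 3 <= pbar m by apply: IHm; lia.
have mn : 343 * n ^ 3 <= 512 * m ^ 3.
  rewrite -[343]/(7 ^ 3) -[512]/(8 ^ 3) -!expnMn leq_exp2r //; lia.
have hn : 512 * n <= 343 * (h * h.+1) by nia.
move=> hp; rewrite -(@leq_pmul2l (343 * n)); last by lia.
have h1 := leq_mul hn IHm.
have h2 := leq_mul (leqnn (n * K)) mn.
by move: h1 h2 hp; clearbody m h; move: (h * h.+1) (n ^ 3) (m ^ 3) => u v w; lia.
Qed.

Lemma pbar_rec_low (N t : nat) : t <= N ->
  \sum_(0 <= i < t) ssum (N - i) * pbar i <= N * N.+1 * (t * pbar t).
Proof.
move=> tN; rewrite mulnCA -{2}[t]subn0 -sum_nat_const_nat !big_nat.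
apply: leq_sum => i /andP[_ it]; apply: leq_mul; last exact/pbar_homo/ltnW.
by apply: (leq_trans (ssum_le _)); apply: leq_mul; lia.
Qed.

Lemma ratio_step (C D e m b : nat) : m <= b -> 0 < b + e ->
  (forall b', m <= b' < b -> C * pbar (b' + e) <= D * pbar b') ->
  C * ((b + e) * (b + e).+1 * ((m + e) * pbar (m + e))) <= D * e * pbar b ->
  C * pbar (b + e) <= D * pbar b.
Proof.
move=> mb be0 IHb slack; rewrite -(@leq_pmul2l (b + e)) // mulnCA pbar_rec.
rewrite (big_cat_nat (n := m + e)) ?leq_add2r //= mulnDr.
(* D b pbar b pays for the terms i >= m + e, by hypothesis; D e pbar b pays for the boundary
   terms. *)
have -> : (b + e) * (D * pbar b) = D * e * pbar b + D * (b * pbar b) by lia.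
apply: leq_add.
  by apply: leq_trans slack; rewrite leq_mul2l pbar_rec_low ?orbT // leq_add2r.
rewrite big_addn addnK pbar_rec [in leqRHS](big_cat_nat (n := m)) //= mulnDr.
apply: leq_trans (leq_addl _ _); rewrite !big_distrr /= !big_nat.
apply: leq_sum => i /IHb; rewrite [C * (_ * _)]mulnCA [D * (_ * _)]mulnCA subnDr.
exact: leq_mul.
Qed.

Lemma ratio_bound (C D e m B : nat) : 0 < B ->
  (forall b, m <= b <= B -> C * pbar (b + e) <= D * pbar b) ->
  (forall b, B < b ->
     C * ((b + e) * (b + e).+1 * ((m + e) * pbar (m + e))) <= D * e * pbar b) ->
  forall b, m <= b -> C * pbar (b + e) <= D * pbar b.
Proof.
move=> B0 base slack; elim/ltn_ind => b IHb mb.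
case: (leqP b B) => bB; first by apply: base; rewrite mb.
apply: ratio_step mb _ _ (slack b bB) => [|b' /andP[mb' b'b]]; first by lia.
exact: IHb.
Qed.

Lemma submult_bound (C d m B : nat) :
  (forall a b, m <= a -> a <= b -> b <= B ->
     C * pbar (a + b + d) <= pbar a * pbar b) ->
  (forall a b, m <= a -> a <= b -> B < b ->
     C * ((a + b + d) * (a + b + d).+1 * ((m + a + d) * pbar (m + a + d)))
       <= pbar a * (a + d) * pbar b) ->
  forall a b, m <= a -> m <= b -> C * pbar (a + b + d) <= pbar a * pbar b.
Proof.
move=> base slack.
suff H n a b : a + b = n -> m <= a -> a <= b -> C * pbar (a + b + d) <= pbar a * pbar b.
  move=> a b ma mb; case: (leqP a b) => [|/ltnW] ab; first exact: H.
  by rewrite [a + b]addnC [pbar a * _]mulnC; exact: H.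
elim/ltn_ind: n a b => n IHn a b abn ma ab.
case: (leqP b B) => bB; first exact: base.
have := slack _ _ ma ab bB.
rewrite [a + b]addnC -!addnA => {}slack.
apply: ratio_step slack => [||b' /andP[mb' b'b]]; [lia|lia|].
(* [b'] may lie below [a]; symmetry restores the order that the induction asks for. *)
rewrite addnCA addnA; case: (leqP a b') => [|/ltnW] ab'.
  by apply: (IHn (a + b')) => //; lia.
by rewrite [a + b']addnC [pbar a * _]mulnC; apply: (IHn (b' + a)) => //; lia.
Qed.

(** * The harmonic bound *)

(** Both hypotheses are proved further down, under the same names, where exact tables supply the
    base cases. *)
Section Harmonic.

Hypothesis pbar_cube : forall n, 30 <= n -> n ^ 3 <= pbar n.
Hypothesis pbar_submult : forall a b, pbar (a + b) <= pbar a * pbar b.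

Lemma pbar_le_pow2 (n : nat) : pbar n <= 2 ^ n.
Proof.
elim: n => [|n IHn]; first by rewrite pbar0.
have -> : n.+1 = 1 + n by [].
rewrite expnD; apply: leq_trans (pbar_submult 1 n) _.
by apply: leq_mul => //; rewrite /pbar /ov cnt1.
Qed.

Lemma pbar_growth_iter (n h j : nat) : j * h <= n ->
  h ^ (2 * j) * pbar (n - j * h) <= n ^ j * pbar n.
Proof.
elim: j => [|j IHj] jn; first by rewrite mul0n subn0 muln0.
have jn' : j * h <= n by rewrite mulSn in jn; lia.
have := pbar_growth (n - j.+1 * h) h.
have -> : n - j.+1 * h + h = n - j * h by rewrite mulSn in jn *; lia.
move=> step; have {}IHj := IHj jn'.
rewrite mulnS expnD -mulnA mulnCA [n ^ _]expnS.
have le1 : h ^ 2 * pbar (n - j.+1 * h) <= n * pbar (n - j * h).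
  apply: leq_trans (leq_trans step _); last by rewrite leq_mul2r leq_subr orbT.
  by rewrite leq_mul2r -mulnn leq_mul2l leqnSn !orbT.
apply: (leq_trans (leq_mul (leqnn (h ^ (2 * j))) le1)).
by rewrite mulnCA -mulnA leq_mul2l IHj orbT.
Qed.

(** Seven growth steps with h = n %/ 35 descend to t = n - 7 h >= 4 n / 5 and gain h^14 / n^7. From
    n <= q h and 8 q^10 <= h^4 follows h^14 >= 8 n^10, and 8 n^3 >= 4 n^2 (n + 1). *)
Lemma pbar_decay (q n : nat) : 36 <= q -> q ^ 4 <= n ->
  exists t, [/\ t <= n, 4 * n <= 5 * t & 4 * (n * n * n.+1 * pbar t) <= pbar n].
Proof.
move=> q36 qn; pose h := n %/ 35; exists (n - 7 * h).
have q4 : q ^ 4 = q * q ^ 3 by rewrite expnS.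
have hq : q ^ 3 <= h by rewrite leq_divRL // mulnC; apply: leq_trans qn; rewrite q4 leq_mul //; lia.
have h35 : 35 <= h by apply: leq_trans hq; rewrite (leq_trans _ (leq_pexp2l _ (isT : 1 <= 3))) //; lia.
have hn : 35 * h <= n by rewrite /h; lia.
have nh : n <= q * h by apply: (@leq_trans (36 * h)); [rewrite /h; rewrite /h in h35; lia | rewrite leq_mul].
split; [by lia | by lia |].
have := @pbar_growth_iter n h 7; rewrite (_ : 2 * 7 = 4 + 10) // => it.
have {}it : h ^ (4 + 10) * pbar (n - 7 * h) <= n ^ 7 * pbar n by apply: it; lia.
have n0 : 0 < n by lia.
rewrite -(@leq_pmul2l (n ^ 7)) ?expn_gt0 ?n0 //; apply: leq_trans it.
move: (pbar (n - 7 * h)) => P.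
rewrite !mulnA leq_mul2r; apply/orP; right.
have n10 : n ^ 10 <= q ^ 10 * h ^ 10 by rewrite -expnMn leq_exp2r.
have h4 : 8 * q ^ 10 <= h ^ 4.
  apply: (@leq_trans ((q ^ 3) ^ 4)); last by rewrite leq_exp2r.
  have -> : (q ^ 3) ^ 4 = q ^ 2 * q ^ 10 by rewrite -expnM -expnD.
  rewrite leq_mul2r; apply/orP; right.
  by rewrite (@leq_trans (6 ^ 2)) // leq_exp2r //; lia.
apply: (@leq_trans (8 * n ^ 10)).
  have -> : n ^ 10 = n ^ 7 * n ^ 3 by rewrite -expnD.
  rewrite mulnCA -!mulnA leq_mul2l; apply/orP; right.
  by rewrite !expnS expn0; nia.
apply: (leq_trans (leq_mul (leqnn 8) n10)).
by rewrite expnD mulnA leq_mul.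
Qed.

Lemma harmonic_submult (K a b : nat) :
  (exists2 q, 36 <= q & K = q ^ 4) -> 0 < a -> 0 < b ->
  a * b * pbar (a + b) <= K * (a + b) * (pbar a * pbar b).
Proof.
case=> q q36 KE.
have K48 : 48 <= K by rewrite KE (@leq_trans (3 ^ 4)) // leq_exp2r //; lia.
suff H n a' b' : a' + b' = n -> 0 < a' -> a' <= b' ->
  a' * b' * pbar (a' + b') <= K * (a' + b') * (pbar a' * pbar b').
  move=> a0 b0; case: (leqP a b) => [|/ltnW] ab; first exact: H.
  by rewrite [a + b]addnC [a * b]mulnC [pbar a * _]mulnC; exact: H.
elim/ltn_ind: n a' b' => n IHn {}a {}b abn a0 ab.
(* For b < K the factor K (a + b) is already at least a b. *)
case: (ltnP b K) => [bK|Kb].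
  apply: leq_mul (pbar_submult a b).
  by apply: (@leq_trans (K * b)); rewrite ?leq_mul2r ?leq_mul2l ?leq_addl ?orbT //; lia.
have [t [tb t4 tP]] := pbar_decay q36 (leq_trans (eq_leq (esym KE)) Kb).
have t0 : 0 < t by lia.
have IHab b' : 0 < b' -> b' < b ->
    a * b' * pbar (a + b') <= K * (a + b') * (pbar a * pbar b').
  move=> b'0 b'b; case: (leqP a b') => [|/ltnW] ab'.
    by apply: (IHn (a + b')) => //; lia.
  rewrite [a + b']addnC [a * _]mulnC [pbar a * _]mulnC.
  by apply: (IHn (b' + a)) => //; lia.
(* Since b <= 5 b' / 4 here, 1/b' is at most 5/4 of 1/b. *)
have bound_hi b' : t <= b' -> b' < b ->
    4 * (a * b) * pbar (a + b') <= K * pbar a * (5 * a + 4 * b) * pbar b'.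
  move=> tb' b'b; have b'0 : 0 < b' by lia.
  have := IHab _ b'0 b'b; move: (pbar (a + b')) (pbar a) (pbar b') => X A B le1.
  rewrite -(@leq_pmul2l b') //.
  apply: (@leq_trans (4 * b * (K * (a + b') * (A * B)))).
    apply: leq_trans (leq_mul (leqnn (4 * b)) le1); apply: eq_leq; ring.
  rewrite [leqLHS](_ : _ = (K * A * B) * (4 * b * (a + b'))); last by ring.
  rewrite [leqRHS](_ : _ = (K * A * B) * (b' * (5 * a + 4 * b))); last by ring.
  by rewrite leq_mul2l; apply/orP; right; clear -tb' t4; nia.
(* Far below b the bound loses a further 4 a b, which the decay of [pbar] up to t makes harmless. *)
have bound_lo b' : 0 < b' -> b' < t ->
    4 * (a * b) * pbar (a + b') <= K * pbar a * (5 * a + 4 * b) * pbar b' +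
      K * pbar a * (4 * (a * b)) * pbar b'.
  move=> b'0 b't; have := IHab _ b'0 (leq_trans b't tb).
  move: (pbar (a + b')) (pbar a) (pbar b') => X A B le1.
  rewrite -(@leq_pmul2l b') //.
  apply: (@leq_trans (4 * b * (K * (a + b') * (A * B)))).
    apply: leq_trans (leq_mul (leqnn (4 * b)) le1); apply: eq_leq; ring.
  rewrite [leqLHS](_ : _ = (K * A * B) * (4 * b * (a + b'))); last by ring.
  rewrite [leqRHS](_ : _ = (K * A * B) * (b' * (5 * a + 4 * b + 4 * (a * b)))); last by ring.
  rewrite leq_mul2l; apply/orP; right.
  have h1 : a * b <= b' * (a * b) by rewrite leq_pmull.
  have h2 : b <= b' * b by rewrite leq_pmull.
  by clear -h1 h2; nia.
(* The terms i <= a are not a + b' with b' > 0, so the induction hypothesis does not reach them; the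
   cube bound absorbs them. *)
have low : \sum_(0 <= i < a.+1) ssum (a + b - i) * pbar i <=
    (2 * b) * (2 * b).+1 * (b.+1 * (2 * pbar a)).
  apply: (leq_trans (pbar_rec_low _)); first by lia.
  apply: leq_mul; first by apply: leq_mul; lia.
  apply: leq_mul; first by lia.
  by apply: (leq_trans (pbar_submult 1 a)); rewrite leq_mul2r /pbar /ov cnt1 orbT.
have low2 : 2 * \sum_(0 <= i < a.+1) ssum (a + b - i) * pbar i <= K * (pbar a * pbar b).
  apply: (leq_trans (leq_mul (leqnn 2) low)).
  have b3 : b ^ 3 <= pbar b by apply: pbar_cube; lia.
  apply: (@leq_trans (48 * (pbar a * b ^ 3))); last first.
    by apply: leq_mul => //; rewrite leq_mul2l b3 orbT.
  rewrite [leqLHS](_ : _ = pbar a * (8 * (b * (2 * b).+1 * b.+1))); last by ring.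
  rewrite [48 * _]mulnCA leq_mul2l; apply/orP; right.
  have {}Kb : 48 <= b by lia.
  by clear -Kb; rewrite !expnS expn0; nia.
have high : 4 * (a * b) * \sum_(1 <= i < b) ssum (b - i) * pbar (a + i) <=
    K * pbar a * (5 * a + 4 * b) * (b * pbar b) + K * pbar a * (a * b) * pbar b.
  rewrite pbar_rec big_distrr /= (big_cat_nat (n := t)) //=.
  rewrite [in leqRHS](big_cat_nat (n := t)) //= [in leqRHS]mulnDr addnAC leq_add //; last first.
    rewrite !big_distrr /= !big_nat; apply: leq_sum => i /andP[ti ib].
    by rewrite !(mulnCA _ (ssum _)) leq_mul2l bound_hi ?orbT.
  apply: (@leq_trans (\sum_(1 <= i < t) ssum (b - i) *
      (K * pbar a * (5 * a + 4 * b) * pbar i + K * pbar a * (4 * (a * b)) * pbar i))).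
    rewrite !big_nat; apply: leq_sum => i /andP[i1 it].
    by rewrite mulnCA leq_mul2l bound_lo ?orbT.
  rewrite (big_ltn t0) [in leqRHS]mulnDr -[leqRHS]addnA; apply: leq_trans (leq_addl _ _).
  have -> : \sum_(1 <= i < t) ssum (b - i) * (K * pbar a * (5 * a + 4 * b) * pbar i +
       K * pbar a * (4 * (a * b)) * pbar i) =
     K * pbar a * (5 * a + 4 * b) * (\sum_(1 <= i < t) ssum (b - i) * pbar i) +
     K * pbar a * (4 * (a * b)) * (\sum_(1 <= i < t) ssum (b - i) * pbar i).
    rewrite !big_distrr -big_split; apply: eq_bigr => i _ /=; rewrite mulnDr.
    by rewrite !(mulnCA (ssum _)).
  rewrite leq_add2l.
  rewrite -[_ * _ * pbar b]mulnA [K * pbar a * (4 * _)]mulnA [K * pbar a * 4]mulnC.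
  rewrite -!mulnA [4 * (K * _)]mulnCA leq_mul2l; apply/orP; right.
  rewrite [4 * (pbar a * _)]mulnCA leq_mul2l; apply/orP; right.
  rewrite [4 * (a * _)]mulnCA leq_mul2l; apply/orP; right.
  rewrite [4 * (b * _)]mulnCA leq_mul2l; apply/orP; right.
  apply: leq_trans tP; rewrite leq_mul2l /=.
  apply: (@leq_trans (b * b.+1 * (t * pbar t))).
    apply: leq_trans (pbar_rec_low tb); rewrite [leqRHS]big_ltn //; exact: leq_addl.
  rewrite mulnA leq_mul2r; apply/orP; right.
  by rewrite mulnAC leq_mul2r leq_mul2l tb !orbT.
(* The coefficients of K pbar a pbar b are (5 a + 4 b) b for the main terms, a b for the excess of
   [bound_lo] and 2 a b for [low2]: in all 8 a b + 4 b^2 <= 4 (a + b)^2. *)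
rewrite -(@leq_pmul2l (4 * (a + b))); last by clear -a0; lia.
rewrite [leqLHS](_ : _ = 4 * (a * b) * ((a + b) * pbar (a + b))); last by ring.
rewrite pbar_rec (big_cat_nat (n := a.+1)) //=; last by clear -a0 ab; lia.
rewrite mulnDr addnC.
have -> : \sum_(a.+1 <= i < a + b) ssum (a + b - i) * pbar i =
   \sum_(1 <= i < b) ssum (b - i) * pbar (a + i).
  rewrite -[a.+1]add1n big_addn addKn; apply: eq_bigr => i _.
  by rewrite [i + a]addnC subnDl.
have {}low2 := leq_mul (leqnn (2 * (a * b))) low2.
rewrite [X in _ + X <= _](_ : _ = 2 * (a * b) *
  (2 * \sum_(0 <= i < a.+1) ssum (a + b - i) * pbar i)); last by ring.
apply: (leq_trans (leq_add high low2)).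
move: (pbar a) (pbar b) => A B.
rewrite [leqLHS](_ : _ = K * A * B * (8 * (a * b) + 4 * (b * b))); last by ring.
rewrite [leqRHS](_ : _ = K * A * B * (4 * ((a + b) * (a + b)))); last by ring.
by rewrite leq_mul2l; apply/orP; right; clear; nia.
Qed.

End Harmonic.

(** * Exact tables *)

Definition vadd (u v : seq N) : seq N := [seq N.add p.1 p.2 | p <- zip u v].

Definition vdbl (u : seq N) : seq N := [seq N.double x | x <- u].

(* Computes the [T] with [T = z q^L (g + T)], where [z] marks the number of parts
   modulo [c] (so [z] acts by [rotr 1]): [t] holds the [L] entries of [T] aligned
   with the head of [g], and each block of [L] entries determines the next. *)
Fixpoint stream (fuel L : nat) (t g : seq (seq N)) {struct fuel} : seq (seq N) :=
  if fuel is f.+1 then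
    if g is [::] then [::] else
    t ++ stream f L [seq rotr 1 (vadd p.1 p.2) | p <- zip t (take L g)] (drop L g)
  else [::].

(* Overpartitions that contain the part [L], from the entry [L] on. *)
Definition news (c L : nat) (g : seq (seq N)) : seq (seq N) :=
  map vdbl (take (size g - L) (drop L (stream (size g) L (nseq L (nseq c N0)) g))).

Definition merge_from (L : nat) (f : seq N -> seq N -> seq N) (g w : seq (seq N)) :
    seq (seq N) :=
  take L g ++ [seq f p.1 p.2 | p <- zip (drop L g) w].

Definition cnt_step (L : nat) (g w : seq (seq N)) : seq (seq N) :=
  merge_from L vadd g w.

(** Rank [a] with largest part [L] means L - a parts modulo [c]; adding [c] first avoids truncated
    subtraction. *)
Definition rnk_step (c L : nat) (r w : seq (seq N)) : seq (seq N) :=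
  let idx := [seq (L + (c - a)) %% c | a <- iota 0 c] in
  merge_from L (fun u v => vadd u [seq nth N0 v i | i <- idx]) r w.

Fixpoint cnt_run (c k L : nat) (g : seq (seq N)) : seq (seq N) :=
  if k is k'.+1 then cnt_run c k' L.+1 (cnt_step L g (news c L g)) else g.

Fixpoint rnk_run (c k L : nat) (g r : seq (seq N)) : seq (seq N) :=
  if k is k'.+1 then
    let w := news c L g in rnk_run c k' L.+1 (cnt_step L g w) (rnk_step c L r w)
  else r.

(** Only the empty overpartition, with no parts and rank 0, so both runs can start here. *)
Definition table0 (c M : nat) : seq (seq N) :=
  (Npos xH :: nseq c.-1 N0) :: nseq M (nseq c N0).

Definition pbar_table (M : nat) : seq N :=
  map (head N0) (cnt_run 1 M 1 (table0 1 M)).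

Definition Nbar_table (c M : nat) : seq (seq N) :=
  rnk_run c M 1 (table0 c M) (table0 c M).

(** * Correctness of the tables *)

Lemma nat_of_addN (x y : N) : nat_of_bin (N.add x y) = nat_of_bin x + nat_of_bin y.
Proof. by case: x => [|x]; case: y => [|y] //=; rewrite ?addn0 // nat_of_add_pos. Qed.

Lemma nat_of_mulN (x y : N) : nat_of_bin (N.mul x y) = nat_of_bin x * nat_of_bin y.
Proof. by case: x => [|x]; case: y => [|y] //=; rewrite ?muln0 // nat_of_mul_pos. Qed.

Lemma nat_of_doubleN (x : N) : nat_of_bin (N.double x) = (nat_of_bin x).*2.
Proof. by case: x => [|x] //=; rewrite NatTrec.doubleE. Qed.

Lemma nat_of_leN (x y : N) : N.leb x y -> nat_of_bin x <= nat_of_bin y.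
Proof.
move/N.leb_le => /N.sub_add <-; rewrite nat_of_addN; exact: leq_addl.
Qed.

Section Tables.

Variable c : nat.
Hypothesis c_gt0 : 0 < c.

Definition rep1 (v : seq N) (F : nat -> nat) : Prop :=
  size v = c /\ forall s, s < c -> nat_of_bin (nth N0 v s) = F s.

Definition rep (l : seq (seq N)) (x : nat) (G : nat -> nat -> nat) : Prop :=
  forall i, i < size l -> rep1 (nth [::] l i) (G (x + i)).

Lemma rep1_ext (v : seq N) (F F' : nat -> nat) :
  (forall s, s < c -> F s = F' s) -> rep1 v F -> rep1 v F'.
Proof. by move=> FF' [sv vF]; split=> // s sc; rewrite vF ?FF'. Qed.

Lemma rep1_add (u v : seq N) (F F' : nat -> nat) :
  rep1 u F -> rep1 v F' -> rep1 (vadd u v) (fun s => F s + F' s).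
Proof.
move=> [su uF] [sv vF]; have suv : size (zip u v) = c by rewrite size1_zip su ?sv.
split=> [|s sc]; first by rewrite size_map.
by rewrite (nth_map (N0, N0)) ?suv // nth_zip ?su ?sv //= nat_of_addN uF ?vF.
Qed.

Lemma rep1_dbl (u : seq N) (F : nat -> nat) :
  rep1 u F -> rep1 (vdbl u) (fun s => (F s).*2).
Proof.
move=> [su uF]; split=> [|s sc]; first by rewrite size_map.
by rewrite (nth_map N0) ?su // nat_of_doubleN uF.
Qed.

(** [(s + c.-1) %% c] is s - 1 modulo [c]: one more part moves each class up by one. *)
Lemma rep1_rotr (u : seq N) (F : nat -> nat) :
  rep1 u F -> rep1 (rotr 1 u) (fun s => F ((s + c.-1) %% c)).
Proof.
case; case/lastP: u => [|u x]; first by move=> cE; move: c_gt0; rewrite -cE.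
rewrite size_rcons => su uF; rewrite rotr1_rcons; split=> // s sc.
case: s sc => [|s] sc /=.
  rewrite add0n modn_small ?prednK // -uF ?prednK // nth_rcons -su /= ltnn eqxx //.
have -> : (s.+1 + c.-1) %% c = s.
  by rewrite addSnnS prednK // modnDr modn_small // ltnW.
by rewrite -uF ?(ltnW sc) // nth_rcons (_ : s < size u) //; lia.
Qed.

Lemma rep_stream (G T : nat -> nat -> nat) (L : nat) : 0 < L ->
  (forall n s, s < c -> T (n + L) s = T n ((s + c.-1) %% c) + G n ((s + c.-1) %% c)) ->
  forall fuel x t g, size g <= fuel -> size t = L -> rep t x T -> rep g x G ->
  forall i, i < size g -> rep1 (nth [::] (stream fuel L t g) i) (T (x + i)) /\
    i < size (stream fuel L t g).
Proof.
move=> L0 TG; elim=> [|f IHf] x t g gf tL tT gG i ig; first by lia.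
have -> : stream f.+1 L t g = t ++ stream f L [seq rotr 1 (vadd p.1 p.2) | p <- zip t (take L g)] (drop L g).
  by case: (g) ig.
rewrite nth_cat size_cat tL; case: (ltnP i L) => iL.
  by split; [apply: tT; rewrite tL | rewrite ltn_addr].
have Lg : L < size g by lia.
have sz : size (zip t (take L g)) = L by rewrite size1_zip tL // size_take Lg.
have [] // := IHf (x + L) [seq rotr 1 (vadd p.1 p.2) | p <- zip t (take L g)] (drop L g) _ _ _ _ (i - L).
- by rewrite size_drop; lia.
- by rewrite size_map.
- move=> j; rewrite size_map sz => jL.
  rewrite (nth_map ([::], [::])) ?sz // nth_zip ?tL ?size_take ?Lg //= nth_take //.
  have := rep1_rotr (rep1_add (tT j _) (gG j _)); rewrite tL => /(_ jL (ltn_trans jL Lg)).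
  by apply: rep1_ext => s sc; rewrite addnAC TG.
- move=> j; rewrite size_drop => jL; rewrite nth_drop -addnA; apply: gG; lia.
- by rewrite size_drop; lia.
rewrite -addnA subnKC // => H1 H2; split=> //; lia.
Qed.

Definition res_class (s k : nat) : bool := k %% c == s.

Lemma res_classS (s k : nat) : s < c ->
  res_class s k.+1 = res_class ((s + c.-1) %% c) k.
Proof.
move=> sc; rewrite /res_class -{1}(modn_small sc) -(eqn_modDr c.-1).
by rewrite addSnnS prednK // modnDr.
Qed.

Lemma rank_class_res (a L k : nat) : a < c ->
  rank_class a%:Z c L k = res_class ((L + (c - a)) %% c) k.
Proof.
move=> ac; rewrite /rank_class /res_class -(eqz_modDr k%:Z) subrK -PoszD !modz_nat eqz_nat.
rewrite -(eqn_modDr a k) -addnA subnK ?(ltnW ac) // modnDr eq_sym.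
by rewrite [k + a]addnC.
Qed.

Definition cnt_fun (L n s : nat) : nat := cnt L (res_class s) n.

(** The series T of [stream] for the part [L.+1], before the doubling for the overline. *)
Definition shift_fun (L n s : nat) : nat :=
  if L < n then dnt L.+1 (fun k => res_class s k.+1) (n - L.+1) else 0.

Lemma cnt_ext (L n : nat) (Q Q' : pred nat) : Q =1 Q' -> cnt L Q n = cnt L Q' n.
Proof. by move=> QQ'; apply: eq_count => s; exact: QQ'. Qed.

Lemma dnt_ext (L n : nat) (Q Q' : pred nat) : Q =1 Q' -> dnt L Q n = dnt L Q' n.
Proof. by move=> QQ'; apply: eq_count => s; exact: QQ'. Qed.

Lemma shift_funE (L n s : nat) : s < c ->
  shift_fun L (n + L.+1) s =
  shift_fun L n ((s + c.-1) %% c) + cnt_fun L n ((s + c.-1) %% c).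
Proof.
move=> sc; rewrite /shift_fun [L < n + _](_ : _ = true); last by lia.
rewrite addnK (dnt_ext _ _ (fun k => res_classS k sc)) dntS addnC.
by case: ifP.
Qed.

Lemma rep_news (L : nat) (g : seq (seq N)) : rep g 0 (cnt_fun L) ->
  size (news c L.+1 g) = size g - L.+1 /\
  rep (news c L.+1 g) L.+1 (fun n s => (shift_fun L n s).*2).
Proof.
move=> gG.
have t0 : rep (nseq L.+1 (nseq c N0)) 0 (shift_fun L).
  move=> i; rewrite size_nseq => iL; rewrite nth_nseq iL /shift_fun add0n ltnNge -ltnS iL.
  by split=> [|s sc]; rewrite ?size_nseq // nth_nseq; case: ifP.
have st := rep_stream (ltn0Sn L) (@shift_funE L) (leqnn (size g)) (size_nseq _ _) t0 gG.
rewrite /news; set T := stream _ _ _ _ in st *.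
have szT : size g <= size T.
  case: (posnP (size g)) => [->//|g0].
  by have [_] := st (size g).-1 ltac:(by rewrite prednK); rewrite prednK.
have szt : size (take (size g - L.+1) (drop L.+1 T)) = size g - L.+1.
  by rewrite size_take_min size_drop; apply/minn_idPl; rewrite leq_sub2r.
rewrite size_map szt; split=> // i; rewrite size_map szt => ig.
rewrite (nth_map [::]) ?szt // nth_take // nth_drop; apply: rep1_dbl.
by case: (st (L.+1 + i)) => //; lia.
Qed.

Lemma rep_merge_from (L : nat) (f : seq N -> seq N -> seq N) (g w : seq (seq N))
    (G G' H : nat -> nat -> nat) :
  size w = size g - L.+1 -> rep g 0 G -> rep w L.+1 H ->
  (forall n s, n <= L -> G n s = G' n s) ->
  (forall n u v, L < n -> rep1 u (G n) -> rep1 v (H n) -> rep1 (f u v) (G' n)) ->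
  size (merge_from L.+1 f g w) = size g /\ rep (merge_from L.+1 f g w) 0 G'.
Proof.
move=> sw gG wH low high.
have szz : size (zip (drop L.+1 g) w) = size g - L.+1.
  by rewrite size1_zip size_drop // sw.
have szm : size (merge_from L.+1 f g w) = size g.
  by rewrite size_cat size_map szz size_take_min; lia.
split=> // i; rewrite szm => ig; rewrite /merge_from nth_cat size_take_min.
case: ltnP => iL.
  have iL' : i < L.+1 by lia.
  by rewrite nth_take //; apply: rep1_ext (gG i ig) => s _; rewrite low.
have Li : L < i by lia.
have -> : minn L.+1 (size g) = L.+1 by lia.
rewrite (nth_map ([::], [::])) ?szz; last by lia.
rewrite nth_zip ?size_drop ?sw //= nth_drop subnKC //.
apply: high => //; first exact: gG.
by have := wH (i - L.+1); rewrite subnKC // sw; apply; lia.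
Qed.

Lemma rep_cnt_step (L : nat) (g w : seq (seq N)) : size w = size g - L.+1 ->
  rep g 0 (cnt_fun L) -> rep w L.+1 (fun n s => (shift_fun L n s).*2) ->
  size (cnt_step L.+1 g w) = size g /\ rep (cnt_step L.+1 g w) 0 (cnt_fun L.+1).
Proof.
move=> wg gG wT; apply: (rep_merge_from wg gG wT) => [n s nL|n u v Ln uG vT].
  by rewrite /cnt_fun cntS ltnNge nL addn0.
apply: rep1_ext (rep1_add uG vT) => s sc.
by rewrite /cnt_fun cntS /shift_fun Ln.
Qed.

Lemma rep_rnk_step (L : nat) (r w : seq (seq N)) : size w = size r - L.+1 ->
  rep r 0 (fun n a => rnk a%:Z c L n) ->
  rep w L.+1 (fun n s => (shift_fun L n s).*2) ->
  size (rnk_step c L.+1 r w) = size r /\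
  rep (rnk_step c L.+1 r w) 0 (fun n a => rnk a%:Z c L.+1 n).
Proof.
move=> wr rR wT; apply: (rep_merge_from wr rR wT) => [n a nL|n u v Ln uR [szv vT]].
  by rewrite rnkS ltnNge nL addn0.
apply: (@rep1_ext _ (fun a => rnk a%:Z c L n + (shift_fun L n ((L.+1 + (c - a)) %% c)).*2)).
  move=> a ac; rewrite rnkS /shift_fun Ln.
  by congr (_ + _.*2); apply: dnt_ext => k; rewrite rank_class_res.
apply: rep1_add uR _.
split=> [|a ac]; first by rewrite !size_map size_iota.
rewrite (nth_map 0) ?size_map ?size_iota // (nth_map 0) ?size_iota // nth_iota //.
by rewrite vT ?ltn_mod // !add0n.
Qed.

Lemma rep_cnt_run (k L : nat) (g : seq (seq N)) : rep g 0 (cnt_fun L) ->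
  size (cnt_run c k L.+1 g) = size g /\ rep (cnt_run c k L.+1 g) 0 (cnt_fun (L + k)).
Proof.
elim: k L g => [|k IHk] L g gG; first by rewrite addn0.
have [szw wT] := rep_news gG; have [szg gG'] := rep_cnt_step szw gG wT.
by rewrite /= -addSnnS -szg; apply: IHk.
Qed.

Lemma rep_rnk_run (k L : nat) (g r : seq (seq N)) : size g = size r ->
  rep g 0 (cnt_fun L) -> rep r 0 (fun n a => rnk a%:Z c L n) ->
  size (rnk_run c k L.+1 g r) = size r /\
  rep (rnk_run c k L.+1 g r) 0 (fun n a => rnk a%:Z c (L + k) n).
Proof.
elim: k L g r => [|k IHk] L g r gr gG rR; first by rewrite addn0.
have [szw wT] := rep_news gG; have [szg gG'] := rep_cnt_step szw gG wT.
rewrite gr in szw; have [szr rR'] := rep_rnk_step szw rR wT.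
by rewrite /= -addSnnS -szr; apply: IHk => //; rewrite szg gr szr.
Qed.

Lemma rep_table0 (M : nat) (G : nat -> nat -> nat) :
  (forall n s, s < c -> G n s = (n == 0) && (s == 0)) ->
  size (table0 c M) = M.+1 /\ rep (table0 c M) 0 G.
Proof.
move=> G0; rewrite /table0 /= size_nseq; split=> // -[|i] /= iM.
  split=> [|s sc]; first by rewrite /= size_nseq prednK.
  by rewrite G0 //; case: s sc => //= s sc; rewrite nth_nseq; case: ifP.
rewrite ltnS size_nseq in iM; rewrite nth_nseq iM.
by split=> [|s sc]; rewrite ?size_nseq // nth_nseq G0 //=; case: ifP.
Qed.

Lemma rep_cnt_table0 (M : nat) :
  size (table0 c M) = M.+1 /\ rep (table0 c M) 0 (cnt_fun 0).
Proof.
apply: rep_table0 => n s sc.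
by rewrite /cnt_fun cnt0 /res_class mod0n (eq_sym 0 s).
Qed.

Lemma rnk_stable (a : int) (L n : nat) : n <= L -> rnk a c L n = rnk a c n n.
Proof.
move=> /subnKC <-; elim: (L - n) => [|k IHk]; first by rewrite addn0.
by rewrite addnS rnkS IHk ltnNge leq_addr addn0.
Qed.

Lemma Nbar_tableP (M n s : nat) : n <= M -> s < c ->
  nat_of_bin (nth N0 (nth [::] (Nbar_table c M) n) s) = Nbar s%:Z c n.
Proof.
move=> nM sc; have [szg gG] := rep_cnt_table0 M.
have [|_ rR] := @rep_table0 M (fun n a => rnk a%:Z c 0 n).
  move=> m a ac; rewrite /rnk /=; case: eqP => //= _; rewrite addn0.
  by rewrite /rank_pred /overpartition_rank /largest_part /= big_nil subrr mod0z
    modz_nat modn_small // eqz_nat eq_sym.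
have [szt] := rep_rnk_run M (erefl _) gG rR.
move=> /(_ n); rewrite szt szg ltnS => /(_ nM) [_ ->] //.
by rewrite !add0n rnk_stable // NbarE.
Qed.

End Tables.

Lemma pbar_tableP (M n : nat) : n <= M -> nat_of_bin (nth N0 (pbar_table M) n) = pbar n.
Proof.
move=> nM; have [szg gG] := rep_cnt_table0 (ltn0Sn 0) M.
have [szt] := rep_cnt_run (ltn0Sn 0) M gG.
move=> /(_ n); rewrite szt szg ltnS => /(_ nM) [_ /(_ 0 isT)].
rewrite /pbar_table (nth_map [::]) ?szt ?szg // nth0 => ->.
rewrite /cnt_fun !add0n -(ov_stable nM); apply: cnt_ext => k.
by rewrite /res_class modn1.
Qed.

(** * Small moduli *)

(* Keeps [done] from evaluating closed instances such as [pbar 311]. *)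
#[local] Opaque pbar nat_of_bin.

(** Evaluated once and stored. The checks below use [pbar] up to 594 and [Nbar] up to 310. *)
Definition ptab : seq N := Eval vm_compute in pbar_table 600.
Definition ntab3 : seq (seq N) := Eval vm_compute in Nbar_table 3 310.
Definition ntab4 : seq (seq N) := Eval vm_compute in Nbar_table 4 310.
Definition ntab5 : seq (seq N) := Eval vm_compute in Nbar_table 5 310.

Lemma ptabE : ptab = pbar_table 600.
Proof. by vm_cast_no_check (erefl ptab). Qed.

Lemma ntab3E : ntab3 = Nbar_table 3 310.
Proof. by vm_cast_no_check (erefl ntab3). Qed.

Lemma ntab4E : ntab4 = Nbar_table 4 310.
Proof. by vm_cast_no_check (erefl ntab4). Qed.

Lemma ntab5E : ntab5 = Nbar_table 5 310.
Proof. by vm_cast_no_check (erefl ntab5). Qed.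

Definition pb (n : nat) : N := nth N0 ptab n.

Definition row (c n : nat) : seq N :=
  nth [::] (if c == 3 then ntab3 else if c == 4 then ntab4 else ntab5) n.

Lemma pbE (n : nat) : n <= 600 -> nat_of_bin (pb n) = pbar n.
Proof. by move=> n600; rewrite /pb ptabE pbar_tableP. Qed.

Lemma rowE (c s n : nat) : 3 <= c <= 5 -> s < c -> n <= 310 ->
  nat_of_bin (nth N0 (row c n) s) = Nbar s%:Z c n.
Proof.
move=> c35 sc nM; rewrite /row; case: eqP => [cE|c3].
  by rewrite ntab3E; subst c; exact: Nbar_tableP.
case: eqP => [cE|c4]; first by rewrite ntab4E; subst c; exact: Nbar_tableP.
have cE : c = 5 by lia.
by rewrite ntab5E; subst c; exact: Nbar_tableP.
Qed.

Lemma forall_iota (P : pred nat) (m n i : nat) :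
  all P (iota m n) -> m <= i < m + n -> P i.
Proof. by move=> /allP allP imn; apply: allP; rewrite mem_iota. Qed.

Definition nmul (k : nat) (x : N) : N := N.mul (bin_of_nat k) x.

Lemma nat_of_nmul (k : nat) (x : N) : nat_of_bin (nmul k x) = k * nat_of_bin x.
Proof. by rewrite nat_of_mulN bin_of_natK. Qed.

Definition check_submult (C d m n : nat) : bool :=
  all (fun a => all (fun b => (a <= b) ==>
      N.leb (nmul C (pb (a + b + d))) (N.mul (pb a) (pb b)))
    (iota m n)) (iota m n).

Lemma check_submultP (C d m n a b : nat) : check_submult C d m n ->
  (m + n).*2 + d <= 600 -> m <= a -> a <= b -> b < m + n ->
  C * pbar (a + b + d) <= pbar a * pbar b.
Proof.
move=> chk le600 ma ab bn.
have am : m <= a < m + n by lia.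
have bm : m <= b < m + n by lia.
have := forall_iota (forall_iota chk am) bm => /implyP /(_ ab) /nat_of_leN.
by rewrite nat_of_nmul nat_of_mulN !pbE //; lia.
Qed.

Definition check_cubic (K : N) (m n : nat) : bool :=
  all (fun i => N.leb (nmul i (nmul i (nmul i K))) (pb i)) (iota m n).

Lemma check_cubicP (K : N) (m n i : nat) : check_cubic K m n -> m + n <= 600 ->
  m <= i < m + n -> nat_of_bin K * i ^ 3 <= pbar i.
Proof.
move=> chk le600 imn; have /nat_of_leN := forall_iota chk imn.
by rewrite !nat_of_nmul pbE; [rewrite !expnS expn0; lia | lia].
Qed.

Lemma check_submult1 : check_submult 1 0 0 31.
Proof. by vm_compute. Qed.

Lemma check_submult26 : check_submult 26 22 41 160.
Proof. by vm_compute. Qed.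

Lemma check_cubic30 : check_cubic (Npos xH) 30 80.
Proof. by vm_compute. Qed.

Lemma check_cubic200 : check_cubic (nmul 3 (pb 63)) 200 30.
Proof. by vm_compute. Qed.

Lemma pbar_cube (n : nat) : 30 <= n -> n ^ 3 <= pbar n.
Proof.
move: n; suff H n : 30 <= n -> 1 * n ^ 3 <= pbar n by move=> n /H; rewrite mul1n.
apply: cubic_growth => {}n n30 n110.
by apply: (check_cubicP check_cubic30) => //; lia.
Qed.

Lemma pbar_submult (a b : nat) : pbar (a + b) <= pbar a * pbar b.
Proof.
rewrite -[leqLHS]mul1n -[a + b]addn0.
apply: (@submult_bound 1 0 0 30) => // {}a {}b _ ab b30.
  exact: (check_submultP check_submult1).
rewrite !addn0 add0n mul1n [pbar a * a]mulnC [leqRHS]mulnC leq_mul //.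
apply: leq_trans (pbar_cube (ltnW b30)); rewrite !expnS expn0 muln1.
have h : (a + b) * (a + b).+1 <= (2 * b) * (3 * b) by apply: leq_mul; lia.
by apply: leq_trans h _; rewrite mulnACA leq_mul2r; apply/orP; right; lia.
Qed.

(** Tailored to c <= 5: each factor [Nbar] costs at most 5 and a shift of 11 = 2 * 5 + 1, so the
    total shift is 22, and 26 > 5^2 leaves a strict inequality. *)
Lemma pbar_submult_shift (a b : nat) : 41 <= a -> 41 <= b ->
  26 * pbar (a + b + 22) <= pbar a * pbar b.
Proof.
apply: (@submult_bound 26 22 41 200) => {}a {}b a41 ab bB.
  by apply: (check_submultP check_submult26) => //; lia.
have cub : 3 * pbar 63 * b ^ 3 <= pbar b.
  have -> : 3 * pbar 63 = nat_of_bin (nmul 3 (pb 63)) by rewrite nat_of_nmul pbE.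
  apply: (@cubic_growth _ 200) => [n n200 nB|]; last exact: ltnW.
  by apply: (check_cubicP check_cubic200) => //; lia.
(* The boundary index is 63 + a, hence the constant 3 pbar 63 in the cubic bound. *)
have p63 : pbar (41 + a + 22) <= pbar 63 * pbar a.
  by rewrite (_ : 41 + a + 22 = 63 + a) ?pbar_submult //; lia.
have b2 : 52 * ((a + b + 22) * (a + b + 22).+1) <= 3 * b ^ 3.
  rewrite !expnS expn0; clear -ab bB; nia.
have le2 : 41 + a + 22 <= 2 * (a + 22) by clear -a41; lia.
apply: (leq_trans (leq_mul (leqnn 26) (leq_mul (leqnn _) (leq_mul le2 p63)))).
move: (pbar 63) (pbar a) (pbar b) cub {p63} => P A B cub.
rewrite [leqLHS](_ : _ = A * (a + 22) *
    (52 * ((a + b + 22) * (a + b + 22).+1) * P)); last by ring.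
rewrite leq_mul2l; apply/orP; right; apply: leq_trans cub.
by rewrite [leqRHS]mulnAC leq_mul.
Qed.

Lemma nat_of_minN (x y : N) : nat_of_bin (N.min x y) <= nat_of_bin x /\
  nat_of_bin (N.min x y) <= nat_of_bin y.
Proof.
by split; apply: nat_of_leN; apply/N.leb_le; [exact: N.le_min_l | exact: N.le_min_r].
Qed.

Lemma nat_of_maxN (x y : N) : nat_of_bin x <= nat_of_bin (N.max x y) /\
  nat_of_bin y <= nat_of_bin (N.max x y).
Proof.
by split; apply: nat_of_leN; apply/N.leb_le; [exact: N.le_max_l | exact: N.le_max_r].
Qed.

Definition vmin (c : nat) (v : seq N) : N :=
  foldr (fun s => N.min (nth N0 v s)) (nth N0 v 0) (iota 0 c).

Definition vmax (c : nat) (v : seq N) : N :=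
  foldr (fun s => N.max (nth N0 v s)) N0 (iota 0 c).

Lemma vminP (c s : nat) (v : seq N) : s < c ->
  nat_of_bin (vmin c v) <= nat_of_bin (nth N0 v s).
Proof.
rewrite -[s < c]/(0 <= s < 0 + c) -mem_iota /vmin; elim: (iota 0 c) => //= i l IHl.
rewrite inE => /orP[/eqP ->|/IHl]; first exact: (nat_of_minN _ _).1.
by apply: leq_trans; exact: (nat_of_minN _ _).2.
Qed.

Lemma vmaxP (c s : nat) (v : seq N) : s < c ->
  nat_of_bin (nth N0 v s) <= nat_of_bin (vmax c v).
Proof.
rewrite -[s < c]/(0 <= s < 0 + c) -mem_iota /vmax; elim: (iota 0 c) => //= i l IHl.
rewrite inE => /orP[/eqP ->|/IHl le]; first exact: (nat_of_maxN _ _).1.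
by apply: leq_trans le _; exact: (nat_of_maxN _ _).2.
Qed.

(** Minimum over the three moduli and all residues, so that one ratio check serves every case. *)
Definition nmin (n : nat) : N :=
  foldr (fun c => N.min (vmin c (row c n))) (vmin 5 (row 5 n)) [:: 3; 4; 5].

Lemma nminP (c s n : nat) : 3 <= c <= 5 -> s < c -> n <= 310 ->
  nat_of_bin (nmin n) <= Nbar s%:Z c n.
Proof.
move=> c35 sc nM; rewrite -rowE //; apply: leq_trans (vminP _ sc).
have : c \in [:: 3; 4; 5] by rewrite !inE; lia.
rewrite /nmin; elim: [:: 3; 4; 5] => //= i l IHl.
rewrite inE => /orP[/eqP ->|/IHl]; first exact: (nat_of_minN _ _).1.
by apply: leq_trans; exact: (nat_of_minN _ _).2.
Qed.

(** The summand [pb b] reserves one unit of [m] for strictness. With b = n2 - 11 and n1 + n2 > 310,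
    b starts at 300 - n1. *)
Definition check_ratio : bool :=
  all (fun n => let m := nmin n in
    N.leb (bin_of_nat 30) m &&
    all (fun b => N.leb (N.add (nmul 5 (pb (b + (n + 11)))) (pb b)) (N.mul m (pb b)))
        (iota (300 - n) (221 + n)))
    (iota 9 43).

Definition check_exact : bool :=
  all (fun c => all (fun n1 => let m := vmin c (row c n1) in
      all (fun n2 => (n1 <= n2) ==>
        N.leb (N.succ (vmax c (row c (n1 + n2)))) (N.mul m (vmin c (row c n2))))
    (iota 9 (302 - n1))) (iota 9 43)) [:: 3; 4; 5].

Lemma check_ratio_true : check_ratio.
Proof. by vm_compute. Qed.

Lemma check_exact_true : check_exact.
Proof. by vm_compute. Qed.

Lemma Nbar_exact (c s n1 n2 : nat) : 3 <= c <= 5 -> s < c ->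
  9 <= n1 < 52 -> n1 <= n2 -> n1 + n2 <= 310 ->
  Nbar s%:Z c (n1 + n2) < Nbar s%:Z c n1 * Nbar s%:Z c n2.
Proof.
move=> c35 sc n1b n12 n310.
have cl : c \in [:: 3; 4; 5] by rewrite !inE; lia.
have /allP/(_ _ cl) := check_exact_true.
have n2b : 9 <= n2 < 9 + (302 - n1) by lia.
move=> /forall_iota/(_ n1b)/forall_iota/(_ n2b)/implyP/(_ n12)/nat_of_leN.
rewrite -N.add_1_l nat_of_addN nat_of_mulN => lt.
rewrite -!rowE //; try lia.
apply: leq_ltn_trans (vmaxP _ sc) _; apply: (leq_trans lt).
by apply: leq_mul; exact: vminP.
Qed.

Definition check_cubic520 (K : N) : bool :=
  N.leb (pb 311) (nmul 90 K) && check_cubic K 520 75.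

(** The window 520 to 594 is the base that [cubic_growth] asks for at n0 = 520; the witness lies
    just above pbar 311 / 90. *)
Lemma check_cubic520_true : exists K, check_cubic520 K.
Proof. by exists (N.succ (N.div (pb 311) 90%num)); vm_compute. Qed.

Lemma pbar_cubic_large : exists2 K, pbar 311 <= 90 * K &
  forall n, 520 <= n -> K * n ^ 3 <= pbar n.
Proof.
have [K /andP[/nat_of_leN pK chk]] := check_cubic520_true.
exists (nat_of_bin K).
  by rewrite nat_of_nmul (@pbE 311 isT) in pK.
apply: cubic_growth => n n520 nB.
have n595 : 520 <= n < 520 + 75 by clear chk; lia.
exact (check_cubicP chk isT n595).
Qed.

Lemma Nbar_ratio (c s n1 b : nat) : 3 <= c <= 5 -> s < c ->
  9 <= n1 < 52 -> 300 - n1 <= b ->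
  5 * pbar (b + (n1 + 11)) <= (Nbar s%:Z c n1).-1 * pbar b.
Proof.
move=> c35 sc n1b; have n1M : n1 <= 310 by lia.
have /andP[/nat_of_leN] := forall_iota check_ratio_true n1b.
rewrite bin_of_natK => min30 base.
have minN := nminP c35 sc n1M; set m := nat_of_bin _ in min30 minN.
have N30 := leq_trans min30 minN.
apply: (@ratio_bound 5 _ (n1 + 11) _ 520) => // {}b.
  move=> /andP[mb bB].
  have bM : 300 - n1 <= b < 300 - n1 + (221 + n1) by lia.
  have /nat_of_leN := forall_iota base bM.
  rewrite nat_of_addN nat_of_nmul nat_of_mulN -/m !pbE; try lia.
  move=> le; rewrite -subn1 mulnBl mul1n leq_subRL; last by rewrite leq_pmull; lia.
  by rewrite addnC (leq_trans le) // leq_mul2r minN orbT.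
move=> b520; have [K pK cubK] := pbar_cubic_large.
have := cubK b (ltnW b520) => {}cubK.
(* The boundary index does not depend on [n1], so one cubic bound serves all cases. *)
have -> : 300 - n1 + (n1 + 11) = 311 by lia.
apply: (@leq_trans (5 * (2 * (b * b) * (311 * (90 * K))))).
  rewrite leq_mul2l leq_mul //; last by rewrite leq_mul2l pK orbT.
  by clear -b520 n1b; nia.
(* 29 bounds the predecessor of [Nbar] from below by [N30], and 20 bounds n1 + 11. *)
apply: (@leq_trans (29 * 20 * (K * b ^ 3))); last first.
  by apply: leq_mul => //; apply: leq_mul; lia.
rewrite [leqLHS](_ : _ = K * (b * b) * (2799 * 100)); last by ring.
rewrite [leqRHS](_ : _ = K * (b * b) * (580 * b)); last by ring.
by rewrite leq_mul2l; apply/orP; right; lia.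
Qed.

Lemma Nbar_mod (a : int) (c : nat) : 0 < c ->
  exists2 s, s < c & forall n, Nbar a c n = Nbar (Posz s) c n.
Proof.
move=> c0; have cz : (Posz c != 0)%R by rewrite eqz_nat -lt0n.
have sE : Posz `|(a %% Posz c)%Z|%N = (a %% Posz c)%Z by rewrite gez0_abs ?modz_ge0.
exists `|(a %% Posz c)%Z|%N; first by rewrite -ltz_nat sE ltz_pmod.
move=> n; rewrite !NbarE; apply: eq_count => s.
by rewrite /rank_pred sE modz_mod.
Qed.

Lemma Nbar_small_mod (c s n1 n2 : nat) : 3 <= c <= 5 -> s < c ->
  9 <= n1 -> n1 <= n2 ->
  Nbar (Posz s) c (n1 + n2) < Nbar (Posz s) c n1 * Nbar (Posz s) c n2.
Proof.
move=> c35 sc n19 n12.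
have lowN n : 11 <= n -> pbar (n - 11) <= 5 * Nbar (Posz s) c n.
  move=> n11; apply: (@leq_trans (pbar (n - c.*2.+1))); first by apply: pbar_homo; lia.
  have c0 : 0 < c by lia.
  have := pbar_le_Nbar c0 (Posz s) (n - c.*2.+1); rewrite subnK; last by lia.
  by move/leq_trans; apply; rewrite leq_mul2r; apply/orP; right; lia.
have low2 := lowN n2.
(* From 52 on, n1 - 11 and n2 - 11 are at least 41, as [pbar_submult_shift] asks. *)
case: (leqP 52 n1) => [n52|n52].
  apply: (leq_ltn_trans (Nbar_le_pbar _ _ _)).
  have {}low2 := low2 ltac:(lia).
  have := @pbar_submult_shift (n1 - 11) (n2 - 11) ltac:(lia) ltac:(lia).
  have -> : n1 - 11 + (n2 - 11) + 22 = n1 + n2 by lia.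
  have := leq_mul (lowN n1 ltac:(lia)) low2.
  have := pbar_gt0 (n1 + n2); rewrite mulnACA.
  move: (pbar (n1 + n2)) (pbar _ * pbar _) (Nbar _ _ _ * Nbar _ _ _) => x y z.
  by clear; lia.
have n1b : 9 <= n1 < 52 by lia.
case: (leqP (n1 + n2) 310) => n310; first exact: Nbar_exact.
apply: (leq_ltn_trans (Nbar_le_pbar _ _ _)).
have {}low2 := low2 ltac:(lia).
have b300 : 300 - n1 <= n2 - 11 by lia.
have := Nbar_ratio c35 sc n1b b300.
have -> : n2 - 11 + (n1 + 11) = n1 + n2 by lia.
have := pbar_gt0 (n1 + n2).
move: (pbar (n1 + n2)) (pbar _) (Nbar _ _ n1) (Nbar _ _ n2) low2 => x p [|k] l pl x0.
  by rewrite mul0n; lia.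
(* 5 x <= k p <= 5 k l gives x <= k l < (k + 1) l, with l > 0 because x > 0. *)
rewrite /= => /leq_trans /(_ (leq_mul (leqnn k) pl)).
by rewrite mulnCA leq_mul2l /= mulSn => xkl; case: l {pl} xkl => [|l]; nia.
Qed.

Lemma Nbar_small (c : nat) (a : int) (n1 n2 : nat) : 3 <= c <= 5 ->
  9 <= n1 -> 9 <= n2 -> Nbar a c (n1 + n2) < Nbar a c n1 * Nbar a c n2.
Proof.
move=> c35 n19 n29; have c0 : 0 < c by lia.
have [s sc sE] := Nbar_mod a c0; rewrite !sE.
case: (leqP n1 n2) => [|/ltnW] n12; first exact: Nbar_small_mod.
by rewrite addnC mulnC; exact: Nbar_small_mod.
Qed.

(** * Large moduli *)

Lemma Nbar_large (q c : nat) (a : int) (n1 n2 : nat) : 36 <= q -> 0 < c ->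
  2 * (2 ^ (4 * c + 2) * q ^ 4 * c ^ 2) + 2 * c + 1 < n1 ->
  2 * (2 ^ (4 * c + 2) * q ^ 4 * c ^ 2) + 2 * c + 1 < n2 ->
  Nbar a c (n1 + n2) < Nbar a c n1 * Nbar a c n2.
Proof.
set W := _ * c ^ 2 => q36 c0 W1 W2.
have lowN n : c.*2.+1 <= n -> pbar (n - c.*2.+1) <= c * Nbar a c n.
  by move=> cn; have := pbar_le_Nbar c0 a (n - c.*2.+1); rewrite subnK.
have [x1 n1E] : exists x, n1 = x + c.*2.+1 by exists (n1 - c.*2.+1); lia.
have [x2 n2E] : exists x, n2 = x + c.*2.+1 by exists (n2 - c.*2.+1); lia.
have := leq_mul (lowN n1 ltac:(lia)) (lowN n2 ltac:(lia)).
rewrite {1}n1E {1}n2E !addnK mulnACA => low.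
have x1W : 2 * W < x1 by lia.
have x2W : 2 * W < x2 by lia.
apply: (leq_ltn_trans (Nbar_le_pbar _ _ _)).
have harm := @harmonic_submult pbar_cube pbar_submult (q ^ 4) x1 x2
  (ex_intro2 _ _ q q36 erefl) ltac:(lia) ltac:(lia).
have shift : pbar (n1 + n2) <= pbar (x1 + x2) * 2 ^ (4 * c + 2).
  have -> : n1 + n2 = (x1 + x2) + (4 * c + 2) by lia.
  apply: leq_trans (pbar_submult _ _) _.
  by rewrite leq_mul2l (pbar_le_pow2 pbar_submult) orbT.
have x12 : 0 < x1 * x2 by rewrite muln_gt0; lia.
(* That is, W (1/x1 + 1/x2) < 1. W gathers the power of 2 from the shift, the harmonic constant q^4,
   and c^2 from the two equidistribution bounds. *)
have W12 : W * (x1 + x2) < x1 * x2 by clearbody W; clear -x1W x2W; nia.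
rewrite -(@ltn_pmul2l (x1 * x2)) //.
apply: leq_ltn_trans (leq_mul (leqnn (x1 * x2)) shift) _.
rewrite mulnA.
apply: leq_ltn_trans (leq_mul harm (leqnn _)) _.
move: (leq_mul (leqnn (q ^ 4 * (x1 + x2) * 2 ^ (4 * c + 2))) low) => h.
have NN : 0 < Nbar a c n1 * Nbar a c n2.
  have := pbar_gt0 x1; have := pbar_gt0 x2; move: low.
  by case: (_ * Nbar _ _ _) => //; rewrite muln0 leqn0 muln_eq0 => /orP[] /eqP ->.
apply: (@leq_ltn_trans (W * (x1 + x2) * (Nbar a c n1 * Nbar a c n2))).
  apply: leq_trans (leq_trans _ h) _; apply: eq_leq; rewrite /W; ring.
by rewrite ltn_pmul2r.
Qed.

(** The margin is wide: the exponential covers 2^(4 c) <= e^(4 c), c^20 covers c^2, and the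
    numerical constant covers 8 * 36^4 + 1, where the 1 accounts for 2 c + 1 <= c^2. *)
Lemma M_lower (R : realType) (c n : nat) : 6 <= c -> (M R c <= n%:R)%R ->
  2 * (2 ^ (4 * c + 2) * 36 ^ 4 * c ^ 2) + 2 * c + 1 < n.
Proof.
move=> c6 /(lt_le_trans _) Mn; rewrite -(ltr_nat R); apply: Mn.
have pi0 : (0 < pi :> R)%R := pi_gt0 R.
have pi4 : (pi <= 4 :> R)%R by have := pihalf_lt2 R; lra.
have c6R : (6 <= c%:R :> R)%R by rewrite (ler_nat R 6 c).
set x : R := c%:R%R in c6R *; set X : R := (2 ^+ (4 * c))%R.
have X1 : (1 <= X)%R by rewrite exprn_ege1 // ler1n.
have xx : (36 <= x ^+ 2)%R by nra.
have expX : (X <= expR (16 * x ^+ 2 * (2 * x ^+ 2 + pi) / pi ^+ 2))%R.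
  apply: (@le_trans _ _ (expR (4 * c)%:R)%R).
    rewrite -[(4 * c)%:R%R]mulr1 expRM_natl /X.
    rewrite lerXn2r ?nnegrE ?expR_ge0 //.
    by apply: le_trans (expR_ge1Dx 1); lra.
  rewrite ler_expR ler_pdivlMr ?exprn_gt0 // natrM -/x.
  have : (pi ^+ 2 <= 16 :> R)%R by nra.
  have : (0 < pi ^+ 2 :> R)%R by rewrite exprn_gt0.
  move: (pi ^+ 2)%R => p p0 p16.
  have : (4 * x * p <= 4 * x * 16)%R by rewrite ler_wpM2l //; lra.
  nra.
have x20 : (x ^+ 2 <= x ^+ 20)%R by rewrite ler_weXn2l //; lra.
have sumE : ((2 * (2 ^ (4 * c + 2) * 36 ^ 4 * c ^ 2) + 2 * c + 1)%:R =
    2 * (X * 4 * 36 ^+ 4 * x ^+ 2) + 2 * x + 1 :> R)%R.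
  by rewrite !natrD !natrM !natrX exprD -/X -/x; ring.
have k36 : (8 * 36 ^+ 4 + 1 < 1691 / 1000 * 10 ^+ 13 :> R)%R.
  have -> : (36 ^+ 4 = (36 * 36) * (36 * 36) :> R)%R by ring.
  have -> : (10 ^+ 13 = (100 * 100) * (100 * 100) * 10 ^+ 5 :> R)%R by ring.
  have : (1 <= 10 ^+ 5 :> R)%R by rewrite exprn_ege1 // ler1n.
  by move: (10 ^+ 5)%R => t; lra.
have t0 : (0 <= 36 ^+ 4 :> R)%R by rewrite exprn_ge0.
have xx2 : (2 * x + 1 <= x ^+ 2)%R by nra.
rewrite sumE /M -/x.
move: (1691 / 1000 * 10 ^+ 13)%R (36 ^+ 4)%R k36 t0 => k t tk t0.
move: expX x20 xx xx2.
move: (expR _) => e; move: (x ^+ 20)%R (x ^+ 2)%R => x20 x2 Xe x220 x236 xx2.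
have x20' : (0 <= x2)%R by lra.
have y1 : (x2 <= x2 * X)%R by apply: ler_peMr.
have y0 : (0 < x2 * X)%R by lra.
have h1 : ((8 * t + 1) * (x2 * X) < k * (x2 * X))%R by rewrite (ltr_pM2r y0).
have h2 : (x2 * X <= x20 * e)%R by apply: ler_pM => //; lra.
have h3 : (k * (x2 * X) <= k * (x20 * e))%R by apply: ler_wpM2l => //; lra.
rewrite -[ltRHS]mulrA; apply: (lt_le_trans _ h3); apply: le_lt_trans h1.
have -> : (2 * (X * 4 * t * x2) = 8 * t * (x2 * X))%R by ring.
by clear h2 y0; move: (x2 * X)%R y1 => y y1; lra.
Qed.

Theorem theorem1p1 (R : realType) (c : nat) (a : int) (n1 n2 : nat) :
  (3 <= c)%N ->
  ((c <= 5)%N /\ (9 <= n1)%N /\ (9 <= n2)%N) \/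
  ((6 <= c)%N /\ (M R c <= n1%:R)%R /\ (M R c <= n2%:R)%R) ->
  (Nbar a c (n1 + n2) < Nbar a c n1 * Nbar a c n2)%N.
Proof.
move=> c3 [[c5 [n19 n29]]|[c6 [M1 M2]]]; first by apply: Nbar_small; rewrite // c3.
by apply: (@Nbar_large 36) (M_lower c6 M1) (M_lower c6 M2) => //; lia.
Qed.
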